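(* Let $k$ be a field. If $E$ is a fractional Brauer configuration of type MS, then $\Lambda_E$ is a locally bounded special multiserial Frobenius category. In particular, if $E$ is a fractional Brauer graph of type MS, then $\Lambda_E$ is a locally bounded special biserial Frobenius category.
   Context: Fractional Brauer configuration. Let $G=\langle g\rangle$ be an infinite cyclic group. A fractional Brauer configuration (f-BC) is a quadruple $E=(E,P,L,d)$, where $E$ is a (finite or infinite) $G$-set, $P$ and $L$ are two partitions of $E$ ($P(e)$ and $L(e)$ denote the classes containing $e$), and $d:E\to\mathbb{Z}_{+}$ is a function to the positive integers, such that: (f1) $L(e)\subseteq P(e)$ and $P(e)$ is finite for each $e\in E$; (f2) if $L(e_1)=L(e_2)$ then $P(g\cdot e_1)=P(g\cdot e_2)$; (f3) if $e_1,e_2$ lie in the same $\langle g\rangle$-orbit then $d(e_1)=d(e_2)$; (f4) $P(e_1)=P(e_2)$ if and only if $P(g^{d(e_1)}\cdot e_1)=P(g^{d(e_2)}\cdot e_2)$; (f5) $L(e_1)=L(e_2)$ if and only if $L(g^{d(e_1)}\cdot e_1)=L(g^{d(e_2)}\cdot e_2)$; (f6) for all $e,h\in E$ the formal sequence $L(g^{d(e)-1}\cdot e)\cdots L(g\cdot e)L(e)$ is not a proper subsequence (of consecutive terms) of the formal sequence $L(g^{d(h)-1}\cdot h)\cdots L(g\cdot h)L(h)$. $E$ is of type MS if $L(e)=\{e\}$ for every $e\in E$. It is a fractional Brauer graph of type MS if moreover every $P(e)$ has exactly two elements. Category. $Q_E$ is the quiver with vertices $P(e)$ and arrows $L(e):P(e)\to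 P(g\cdot e)$ ($e\in E$); paths are written right to left. $I_E$ is the ideal of the path category $kQ_E$ generated by: (fR1) $L(g^{d(e)-1-k}\cdot e)\cdots L(e)-L(g^{d(h)-1-k}\cdot h)\cdots L(h)$, where $0\le k\le\min\{d(e),d(h)\}$ is an integer, $P(e)=P(h)$ and $L(g^{d(e)-i}\cdot e)=L(g^{d(h)-i}\cdot h)$ for $1\le i\le k$; (fR2) paths $L(e_n)\cdots L(e_1)$ with $n>1$ and $\bigcap_{i=1}^n g^{n-i}\cdot L(e_i)=\emptyset$; (fR3) paths $L(g^{n-1}\cdot e)\cdots L(g\cdot e)L(e)$ with $n>d(e)$. $\Lambda_E=kQ_E/I_E$. Category-theoretic notions. A $k$-category $\Lambda$ is locally bounded if every $\Lambda(x,x)$ is local, distinct objects are non-isomorphic, and for each $x$, $\sum_{y}\dim_k\Lambda(x,y)<\infty$ and $\sum_y\dim_k\Lambda(y,x)<\infty$. A locally bounded category $\Lambda$ is Frobenius if for every object $x$ there are objects $y,z$ with $\Lambda(-,x)\cong D\Lambda(y,-)$ and $\Lambda(x,-)\cong D\Lambda(-,z)$, where $D=\mathrm{Hom}_k(-,k)$. For a locally finite quiver $Q$, an ideal $I$ of $kQ$ is admissible if for each vertex $x$ there is a positive integer $N_x$ with $kQ^{\ge N_x}(x,-)\subseteq I(x,-)\subseteq kQ^{\ge 2}(x,-)$ and $kQ^{\ge N_x}(-,x)\subseteq I(-,x)\subseteq kQ^{\ge2}(-,x)$, where $kQ^{\ge n}$ is the ideal generated by paths of length $\ge n$. A locally bounded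 category $\Lambda$ is special multiserial if $\Lambda\cong kQ/I$ for some locally finite quiver $Q$ and admissible ideal $I$ such that for each arrow $\alpha$ of $Q$ there is at most one arrow $\beta$ with $\beta\alpha\notin I$ and at most one arrow $\gamma$ with $\alpha\gamma\notin I$. It is special biserial if moreover $Q$ can be chosen so that each vertex is the source of at most two arrows and the target of at most two arrows. *)

(* Defs.v *)
From HB Require Import structures.
From mathcomp Require Import all_boot all_algebra.
From mathcomp Require Import boolp classical_sets functions cardinality.
From mathcomp.multinomials Require Import freeg.

Set Implicit Arguments.
Unset Strict Implicit.
Unset Printing Implicit Defensive.

Import GRing.Theory.
Local Open Scope ring_scope.
Local Open Scope classical_set_scope.

Section DualSpace.
Variables (k : fieldType) (V : lmodType k).

Definition is_linform : {pred (V -> k^o)} := fun l => `[< linear l >].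

Lemma is_linform_submod : submod_closed is_linform.
Proof.
split; first by apply/asboolP => a u v; rewrite /= scaler0 addr0.
move=> a l m /asboolP Hl /asboolP Hm; apply/asboolP => b u v.
rewrite addrfctE scalrfctE /= Hl Hm !scalerDr !scalerA (mulrC a b).
by rewrite addrACA.
Qed.

HB.instance Definition _ :=
  GRing.isSubmodClosed.Build k (V -> k^o) is_linform is_linform_submod.

Record dual := Dual {
  dual_fun :> V -> k^o;
  dual_funP : dual_fun \in is_linform }.

HB.instance Definition _ := [isSub for dual_fun].
HB.instance Definition _ := [Choice of dual by <:].
HB.instance Definition _ := [SubChoice_isSubLmodule of dual by <:].

Lemma dual_linear (l : dual) : linear l.
Proof. exact/asboolP/dual_funP. Qed.

Lemma dualP (l m : dual) : l =1 m -> l = m.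
Proof. by move=> lm; apply/val_inj/funext. Qed.

Lemma dualE a (l m : dual) v : (a *: l + m) v = a * l v + m v.
Proof. by []. Qed.

End DualSpace.

Section DualMap.
Variables (k : fieldType) (V W : lmodType k) (f : {linear V -> W}).

Lemma dual_map_subproof (l : dual W) : (fun v => l (f v)) \in @is_linform k V.
Proof. by apply/asboolP => a u v; rewrite linearP (dual_linear l). Qed.

Definition dual_map (l : dual W) : dual V := Dual (dual_map_subproof l).

End DualMap.

Section Dimension.
Variable k : fieldType.

Definition has_dim (V : lmodType k) (n : nat) : Prop :=
  exists b : 'I_n -> V,
    forall v, exists! c : 'rV[k]_n, v = \sum_(i < n) c 0 i *: b i.

(* sum_(y : T) dim_k (F y) < oo, i.e. the finite partial sums are bounded *)
Definition finite_total_dim (T : Type) (F : T -> lmodType k) : Prop :=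
  exists dim : T -> nat, (forall y, has_dim (F y) (dim y)) /\
    exists N : nat, forall n (y : 'I_n -> T), injective y ->
      (\sum_(i < n) dim (y i) <= N)%N.

End Dimension.

Section QuotientModule.
Variables (k : fieldType) (V : lmodType k).
Variables (S : V -> bool) (submodS : submod_closed S).
Local Open Scope quotient_scope.

Let zmodS : GRing.isZmodClosed V S :=
  GRing.isZmodClosed.Build V S (GRing.submod_closedB submodS).
Let I : zmodClosed V := HB.pack S zmodS.

Definition mod_quot := {ideal_quot I}.
HB.instance Definition _ := GRing.Zmodule.on mod_quot.

Definition to_quot (v : V) : mod_quot := \pi_({ideal_quot I}) v.

Lemma to_quotP (u v : V) : to_quot u = to_quot v <-> u - v \in S.
Proof.
change (to_quot u = to_quot v <-> u - v \in I).
by rewrite Quotient.idealrBE; split => /eqP.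
Qed.

Lemma to_quot_surj (q : mod_quot) : exists v, to_quot v = q.
Proof. by exists (repr q); rewrite /to_quot reprK. Qed.

Definition quot_repr (q : mod_quot) : V := repr q.

Lemma quot_reprK q : to_quot (quot_repr q) = q.
Proof. exact: reprK. Qed.

Lemma to_quotD u v : to_quot (u + v) = to_quot u + to_quot v.
Proof. by rewrite /to_quot !piE. Qed.

Definition quot_scale (a : k) (q : mod_quot) : mod_quot :=
  to_quot (a *: quot_repr q).

Lemma quot_scaleE a v : quot_scale a (to_quot v) = to_quot (a *: v).
Proof.
apply/to_quotP; rewrite -scalerBr -[_ *: _]addr0 submodS.2 ?submodS.1 //.
exact/to_quotP/quot_reprK.
Qed.

Lemma quot_scaleA a b q : quot_scale a (quot_scale b q) = quot_scale (a * b) q.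
Proof. by case: (to_quot_surj q) => v <-; rewrite !quot_scaleE scalerA. Qed.

Lemma quot_scale1 : left_id 1 quot_scale.
Proof. by move=> q; case: (to_quot_surj q) => v <-; rewrite quot_scaleE scale1r. Qed.

Lemma quot_scaleDr : right_distributive quot_scale +%R.
Proof.
move=> a q r; case: (to_quot_surj q) => u <-; case: (to_quot_surj r) => v <-.
by rewrite -to_quotD !quot_scaleE -to_quotD scalerDr.
Qed.

Lemma quot_scaleDl q : {morph quot_scale^~ q : a b / a + b}.
Proof.
by move=> a b; case: (to_quot_surj q) => u <-; rewrite !quot_scaleE -to_quotD scalerDl.
Qed.

HB.instance Definition _ := GRing.Zmodule_isLmodule.Build k mod_quot
  quot_scaleA quot_scale1 quot_scaleDr quot_scaleDl.

Lemma to_quot_linear : linear to_quot.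
Proof. by move=> a u v; rewrite to_quotD -quot_scaleE. Qed.

HB.instance Definition _ :=
  GRing.isLinear.Build k V mod_quot _ to_quot to_quot_linear.

End QuotientModule.

(* [comp v u] is the composite "first u, then v". *)
Record kcat (k : fieldType) := KCat {
  obj :> Type;
  hom : obj -> obj -> lmodType k;
  idc : forall x, hom x x;
  comp : forall x y z, hom y z -> hom x y -> hom x z;
  comp_linearl : forall x y z (u : hom x y), linear (fun v : hom y z => comp v u);
  comp_linearr : forall x y z (v : hom y z), linear (fun u : hom x y => comp v u);
  compA : forall x y z t (w : hom z t) (v : hom y z) (u : hom x y),
    comp w (comp v u) = comp (comp w v) u;
  comp_idl : forall x y (u : hom x y), comp (idc y) u = u;
  comp_idr : forall x y (u : hom x y), comp u (idc x) = u }.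

Arguments hom {k C} x y : rename.
Arguments idc {k C} x : rename.
Arguments comp {k C x y z} v u : rename.
Local Notation "v \oc u" := (comp v u) (at level 40, left associativity).

Record kfunctor (k : fieldType) (C D : kcat k) := KFunctor {
  fobj :> C -> D;
  fmap : forall x y : C, {linear hom x y -> hom (fobj x) (fobj y)};
  fmap_id : forall x, fmap x x (idc x) = idc (fobj x);
  fmap_comp : forall x y z (v : hom y z) (u : hom x y),
    fmap x z (v \oc u) = fmap y z v \oc fmap x y u }.

Definition kcat_iso (k : fieldType) (C D : kcat k) : Prop :=
  exists F : kfunctor C D,
    bijective F /\ forall x y : C, bijective (fmap F x y).

Section Isomorphic.
Variables (k : fieldType) (C : kcat k).

Definition obj_iso (x y : C) : Prop :=
  exists (u : hom x y) (v : hom y x), v \oc u = idc x /\ u \oc v = idc y.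

Definition end_left_ideal (x : C) (J : set (hom x x)) : Prop :=
  [/\ J 0, (forall u v, J u -> J v -> J (u + v)) &
      (forall w u, J u -> J (w \oc u))].

Definition end_max_left_ideal (x : C) (J : set (hom x x)) : Prop :=
  [/\ end_left_ideal J, J <> setT &
      forall J', end_left_ideal J' -> J `<=` J' -> J' <> setT -> J' = J].

Definition local_end (x : C) : Prop :=
  exists! J : set (hom x x), end_max_left_ideal J.

Definition locally_bounded : Prop :=
  [/\ forall x : C, local_end x,
      forall x y : C, obj_iso x y -> x = y &
      forall x : C, finite_total_dim (fun y : C => hom x y) /\
                    finite_total_dim (fun y : C => hom y x)].

End Isomorphic.

Section Modules.
Variables (k : fieldType) (C : kcat k).

Record covmod := CovMod {
  cov_ob :> C -> lmodType k;
  cov_map : forall x y : C, hom x y -> {linear cov_ob x -> cov_ob y};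
  cov_linear : forall x y (m : cov_ob x), linear (fun u : hom x y => cov_map u m);
  cov_id : forall x (m : cov_ob x), cov_map (idc x) m = m;
  cov_comp : forall x y z (v : hom y z) (u : hom x y) (m : cov_ob x),
    cov_map (v \oc u) m = cov_map v (cov_map u m) }.

Record conmod := ConMod {
  con_ob :> C -> lmodType k;
  con_map : forall x y : C, hom x y -> {linear con_ob y -> con_ob x};
  con_linear : forall x y (m : con_ob y), linear (fun u : hom x y => con_map u m);
  con_id : forall x (m : con_ob x), con_map (idc x) m = m;
  con_comp : forall x y z (v : hom y z) (u : hom x y) (m : con_ob z),
    con_map (v \oc u) m = con_map u (con_map v m) }.

Definition cov_iso (M N : covmod) : Prop :=
  exists phi : forall x, {linear M x -> N x},
    (forall x, bijective (phi x)) /\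
    forall x y (u : hom x y) (m : M x),
      phi y (cov_map M u m) = cov_map N u (phi x m).

Definition con_iso (M N : conmod) : Prop :=
  exists phi : forall x, {linear M x -> N x},
    (forall x, bijective (phi x)) /\
    forall x y (u : hom x y) (m : M y),
      phi x (con_map M u m) = con_map N u (phi y m).

Section Representable.
Variable a : C.

Definition post (x y : C) (u : hom x y) (m : hom a x) : hom a y := u \oc m.
HB.instance Definition _ x y (u : hom x y) :=
  GRing.isLinear.Build k (hom a x) (hom a y) _ (post u) (comp_linearr u).

Definition pre (x y : C) (u : hom x y) (m : hom y a) : hom x a := m \oc u.
HB.instance Definition _ x y (u : hom x y) :=
  GRing.isLinear.Build k (hom y a) (hom x a) _ (pre u) (comp_linearl u).

Definition hom_from : covmod := @CovMod (fun x => hom a x)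
  (fun x y u => post u)
  (fun x y m => comp_linearl m)
  (fun x m => comp_idl m)
  (fun x y z v u m => esym (compA v u m)).

Definition hom_to : conmod := @ConMod (fun x => hom x a)
  (fun x y u => pre u)
  (fun x y m => comp_linearr m)
  (fun x m => comp_idr m)
  (fun x y z v u m => compA m v u).

End Representable.

Lemma dual_map_linear (V W : lmodType k) (f : {linear V -> W}) :
  linear (dual_map f).
Proof. by move=> a l m; apply: dualP. Qed.
HB.instance Definition _ (V W : lmodType k) (f : {linear V -> W}) :=
  GRing.isLinear.Build k (dual W) (dual V) _ (dual_map f) (dual_map_linear f).

Section DualModules.

Section Cov.
Variable M : covmod.
Lemma dual_cov_linear x y (l : dual (M y)) :
  linear (fun u : hom x y => dual_map (cov_map M u) l).
Proof. by move=> a u v; apply: dualP => m /=; rewrite cov_linear dual_linear. Qed.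
Lemma dual_cov_id x (l : dual (M x)) : dual_map (cov_map M (idc x)) l = l.
Proof. by apply: dualP => m /=; rewrite cov_id. Qed.
Lemma dual_cov_comp x y z (v : hom y z) (u : hom x y) (l : dual (M z)) :
  dual_map (cov_map M (v \oc u)) l =
  dual_map (cov_map M u) (dual_map (cov_map M v) l).
Proof. by apply: dualP => m /=; rewrite cov_comp. Qed.
Definition dual_cov : conmod := @ConMod (fun x => dual (M x))
  (fun x y u => dual_map (cov_map M u))
  dual_cov_linear dual_cov_id dual_cov_comp.
End Cov.

Section Con.
Variable M : conmod.
Lemma dual_con_linear x y (l : dual (M x)) :
  linear (fun u : hom x y => dual_map (con_map M u) l).
Proof. by move=> a u v; apply: dualP => m /=; rewrite con_linear dual_linear. Qed.
Lemma dual_con_id x (l : dual (M x)) : dual_map (con_map M (idc x)) l = l.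
Proof. by apply: dualP => m /=; rewrite con_id. Qed.
Lemma dual_con_comp x y z (v : hom y z) (u : hom x y) (l : dual (M x)) :
  dual_map (con_map M (v \oc u)) l =
  dual_map (con_map M v) (dual_map (con_map M u) l).
Proof. by apply: dualP => m /=; rewrite con_comp. Qed.
Definition dual_con : covmod := @CovMod (fun x => dual (M x))
  (fun x y u => dual_map (con_map M u))
  dual_con_linear dual_con_id dual_con_comp.
End Con.

End DualModules.

Definition frobenius : Prop :=
  forall x : C, exists y z : C,
    con_iso (hom_to x) (dual_cov (hom_from y)) /\
    cov_iso (hom_from x) (dual_con (hom_to z)).

End Modules.

Section Ideals.
Variables (k : fieldType) (C : kcat k).

Unset Implicit Arguments.
Record ideal := Ideal {
  ideal_set :> forall x y : C, set (hom x y);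
  ideal0 : forall x y, ideal_set x y 0;
  idealP : forall x y a u v,
    ideal_set x y u -> ideal_set x y v -> ideal_set x y (a *: u + v);
  ideal_compl : forall x y z (v : hom y z) (u : hom x y),
    ideal_set x y u -> ideal_set x z (v \oc u);
  ideal_compr : forall x y z (v : hom y z) (u : hom x y),
    ideal_set y z v -> ideal_set x z (v \oc u) }.

Arguments ideal0 I x y : rename.
Arguments idealP I {x y} a {u v} : rename.
Arguments ideal_compl I {x y z} v {u} : rename.
Arguments ideal_compr I {x y z v} u : rename.

Section Generated.
Variable R : forall x y : C, set (hom x y).

Definition gen_set (x y : C) : set (hom x y) :=
  [set u | forall I : ideal, (forall a b, R a b `<=` I a b) -> I x y u].

Set Implicit Arguments.

Lemma gen_set0 x y : gen_set x y 0.
Proof. by move=> I _; exact: ideal0. Qed.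
Lemma gen_setP x y a u v :
  gen_set x y u -> gen_set x y v -> gen_set x y (a *: u + v).
Proof. by move=> Hu Hv I RI; apply: idealP; [exact: Hu|exact: Hv]. Qed.
Lemma gen_set_compl x y z (v : hom y z) (u : hom x y) :
  gen_set x y u -> gen_set x z (v \oc u).
Proof. by move=> Hu I RI; apply: ideal_compl; exact: Hu. Qed.
Lemma gen_set_compr x y z (v : hom y z) (u : hom x y) :
  gen_set y z v -> gen_set x z (v \oc u).
Proof. by move=> Hv I RI; apply: ideal_compr; exact: Hv. Qed.

Definition gen_ideal : ideal :=
  @Ideal gen_set gen_set0 gen_setP gen_set_compl gen_set_compr.

End Generated.

Section Quotient.
Variable I : ideal.

Definition ideal_pred (x y : C) : {pred (hom x y)} := fun u => `[< I x y u >].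

Lemma ideal_pred_submod x y : submod_closed (@ideal_pred x y).
Proof.
split; first by apply/asboolP; exact: ideal0.
by move=> a u v /asboolP Hu /asboolP Hv; apply/asboolP; exact: idealP.
Qed.

Definition qhom (x y : C) : lmodType k := mod_quot (@ideal_pred_submod x y).

Definition qclass (x y : C) (u : hom x y) : qhom x y :=
  to_quot (@ideal_pred_submod x y) u.

Lemma qclassP x y (u v : hom x y) : qclass u = qclass v <-> I x y (u - v).
Proof. by rewrite to_quotP; split => [/asboolP|H]; last exact/asboolP. Qed.

Lemma qclass_surj x y (q : qhom x y) : exists u, qclass u = q.
Proof. exact: to_quot_surj. Qed.

Definition qcomp (x y z : C) (v : qhom y z) (u : qhom x y) : qhom x z :=
  qclass (quot_repr v \oc quot_repr u).

Lemma qcompE x y z (v : hom y z) (u : hom x y) :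
  qcomp (qclass v) (qclass u) = qclass (v \oc u).
Proof.
set v' := quot_repr (qclass v); set u' := quot_repr (qclass u).
have Hv : I y z (v' - v) by apply/qclassP; exact: quot_reprK.
have Hu : I x y (u' - u) by apply/qclassP; exact: quot_reprK.
apply/qclassP; rewrite -/v' -/u'.
have -> : v' \oc u' - v \oc u = 1 *: ((v' - v) \oc u') + v \oc (u' - u).
  have /= Hl := comp_linearl u' (-1) v v'.
  have /= Hr := comp_linearr v (-1) u u'.
  rewrite (addrC v') (addrC u') -[- v]scaleN1r -[- u]scaleN1r Hl Hr.
  rewrite !scaleN1r scale1r [- (v \oc u') + _]addrC -[RHS]addrA.
  by rewrite (addrCA (- (v \oc u'))) addNr addr0.
by apply: idealP; [exact: ideal_compr | exact: ideal_compl].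
Qed.

Lemma qclass_linear x y a (u v : hom x y) :
  qclass (a *: u + v) = a *: qclass u + qclass v.
Proof. exact: to_quot_linear. Qed.

Lemma qcomp_linearl x y z (u : qhom x y) :
  linear (fun v : qhom y z => qcomp v u).
Proof.
move=> a v w; case: (qclass_surj u) => u' <-.
case: (qclass_surj v) => v' <-; case: (qclass_surj w) => w' <-.
by rewrite -qclass_linear !qcompE -qclass_linear (comp_linearl u').
Qed.

Lemma qcomp_linearr x y z (v : qhom y z) :
  linear (fun u : qhom x y => qcomp v u).
Proof.
move=> a u w; case: (qclass_surj v) => v' <-.
case: (qclass_surj u) => u' <-; case: (qclass_surj w) => w' <-.
by rewrite -qclass_linear !qcompE -qclass_linear (comp_linearr v').
Qed.

Lemma qcompA x y z t (w : qhom z t) (v : qhom y z) (u : qhom x y) :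
  qcomp w (qcomp v u) = qcomp (qcomp w v) u.
Proof.
case: (qclass_surj w) => w' <-; case: (qclass_surj v) => v' <-.
by case: (qclass_surj u) => u' <-; rewrite !qcompE compA.
Qed.

Lemma qcomp_idl x y (u : qhom x y) : qcomp (qclass (idc y)) u = u.
Proof. by case: (qclass_surj u) => u' <-; rewrite qcompE comp_idl. Qed.

Lemma qcomp_idr x y (u : qhom x y) : qcomp u (qclass (idc x)) = u.
Proof. by case: (qclass_surj u) => u' <-; rewrite qcompE comp_idr. Qed.

Definition quot_cat : kcat k :=
  KCat qcomp_linearl qcomp_linearr qcompA qcomp_idl qcomp_idr.

End Quotient.
End Ideals.

Arguments ideal {k} C.
Arguments ideal_set {k C} I x y _ : rename.
Arguments ideal0 {k C} I x y : rename.
Arguments idealP {k C} I {x y} a {u v} _ _ : rename.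
Arguments ideal_compl {k C} I {x y z} v {u} _ : rename.
Arguments ideal_compr {k C} I {x y z v} u _ : rename.
Arguments gen_set {k C} R x y _.

(* Classically every type carries a choiceType structure, so this is no
   restriction on the vertices and arrows. *)
Record quiver := Quiver {
  vertex : choiceType;
  arrow : choiceType;
  src : arrow -> vertex;
  tgt : arrow -> vertex }.

Section Paths.
Variable Q : quiver.

(* A path is stored as the sequence of its arrows in the order in which they
   are traversed: the path written a_n ... a_1 (right to left) in the
   literature is [:: a_1; ...; a_n]; [::] is the trivial path. *)
Fixpoint is_qpath (x y : vertex Q) (s : seq (arrow Q)) : bool :=
  if s is a :: s' then (src a == x) && is_qpath (tgt a) y s' else x == y.

Record qpath (x y : vertex Q) := QPath {
  qseq :> seq (arrow Q);
  qseqP : is_qpath x y qseq }.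

HB.instance Definition _ x y := [isSub for @qseq x y].
HB.instance Definition _ x y := [Choice of qpath x y by <:].

Lemma is_qpath_cat x y z s t :
  is_qpath x y s -> is_qpath y z t -> is_qpath x z (s ++ t).
Proof.
elim: s x => [|a s IH] x /=; first by move/eqP->.
by case/andP=> -> /IH{}IH /IH ->.
Qed.

Definition qnil x : qpath x x := QPath (eqxx x : is_qpath x x [::]).
(* first p, then q *)
Definition qcat x y z (q : qpath y z) (p : qpath x y) : qpath x z :=
  QPath (is_qpath_cat (qseqP p) (qseqP q)).

End Paths.

Section PathCategory.
Variables (k : fieldType) (Q : quiver).

Definition phom (x y : vertex Q) : lmodType k := {freeg (qpath x y) / k}.

Definition bpath (x y : vertex Q) (p : qpath x y) : phom x y := << p >>.

Lemma fglift_linear (K : choiceType) (M : lmodType k) (f : K -> M) :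
  linear (fglift f : {freeg K / k} -> M).
Proof.
have fgB := lift_is_additive f.
have fg0 : fglift f 0 = 0 by rewrite -(subrr 0) fgB subrr.
have fgN u : fglift f (- u) = - fglift f u.
  by rewrite -[- u]add0r fgB fg0 add0r.
have fgD u v : fglift f (u + v) = fglift f u + fglift f v.
  by rewrite -{1}[v]opprK fgB fgN opprK.
have fgS (I : Type) (r : seq I) (F : I -> {freeg K / k}) :
    fglift f (\sum_(i <- r) F i) = \sum_(i <- r) fglift f (F i).
  by elim/big_rec2: _ => // i y1 y2 _ <-; rewrite fgD.
move=> a u v; rewrite fgD; congr (_ + _).
rewrite -{2}[u]freeg_sumE fgS scaler_sumr.
rewrite [a *: u]/(GRing.scale _ _) /= /fgscale fgS.
by apply: eq_bigr => i _; rewrite !liftU scalerA.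
Qed.

Lemma bpath_ext (x y : vertex Q) (M : lmodType k) (F G : phom x y -> M) :
  linear F -> linear G -> (forall p, F (bpath p) = G (bpath p)) -> F =1 G.
Proof.
move=> LF LG FG u.
have L0 (H : phom x y -> M) : linear H -> H 0 = 0.
  move=> LH; have := LH (-1) 0 0.
  by rewrite scaler0 addr0 => {1}->; rewrite scaleN1r addNr.
rewrite -[u]freeg_sumE.
elim/big_rec: _ => [|p v _ IH]; first by rewrite !L0.
have -> : << coeff p u *g p >> = coeff p u *: (bpath p : phom x y).
  apply/eqP/freeg_eqP => q; rewrite coeffZ !coeffU mul1r.
  by [].
by rewrite LF LG FG IH.
Qed.

Definition pcomp (x y z : vertex Q) (v : phom y z) (u : phom x y) : phom x z :=
  fglift (fun q : qpath y z =>
    fglift (fun p : qpath x y => bpath (qcat q p)) u) v.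

Arguments pcomp {x y z} v u.

Lemma pcompE x y z (q : qpath y z) (p : qpath x y) :
  pcomp (bpath q) (bpath p) = bpath (qcat q p).
Proof. by rewrite /pcomp /bpath !liftU !scale1r. Qed.

Lemma pcomp_linearl x y z (u : phom x y) :
  linear (fun v : phom y z => pcomp v u).
Proof. exact: fglift_linear. Qed.

Lemma pcomp_linearr x y z (v : phom y z) :
  linear (fun u : phom x y => pcomp v u).
Proof.
move=> a u w /=.
suff: pcomp^~ (a *: u + w) =1 (fun v : phom y z => a *: pcomp v u + pcomp v w).
  exact.
apply: bpath_ext => [|b s t|q].
- exact: pcomp_linearl.
- rewrite !pcomp_linearl !scalerDr !scalerA (mulrC a b) -!addrA.
  by congr (_ + _); rewrite addrCA.
- by rewrite /pcomp /bpath !liftU !scale1r fglift_linear.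
Qed.

Lemma linear_comp2 (U V W : lmodType k) (f : U -> V) (g : V -> W) :
  linear f -> linear g -> linear (fun u => g (f u)).
Proof. by move=> Lf Lg a u v; rewrite Lf Lg. Qed.

Lemma pcompA x y z t (w : phom z t) (v : phom y z) (u : phom x y) :
  pcomp w (pcomp v u) = pcomp (pcomp w v) u.
Proof.
apply: (@bpath_ext _ _ _ (fun w => pcomp w (pcomp v u))
  (fun w => pcomp (pcomp w v) u)) => [||r].
- exact: pcomp_linearl.
- exact: linear_comp2 (pcomp_linearl _) (pcomp_linearl _).
apply: (@bpath_ext _ _ _ (fun v => pcomp (bpath r) (pcomp v u))
  (fun v => pcomp (pcomp (bpath r) v) u)) => [||q].
- exact: linear_comp2 (pcomp_linearl _) (pcomp_linearr _).
- exact: linear_comp2 (pcomp_linearr _) (pcomp_linearl _).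
apply: (@bpath_ext _ _ _ (fun u => pcomp (bpath r) (pcomp (bpath q) u))
  (fun u => pcomp (pcomp (bpath r) (bpath q)) u)) => [||p].
- exact: linear_comp2 (pcomp_linearr _) (pcomp_linearr _).
- exact: pcomp_linearr.
by rewrite !pcompE; congr bpath; apply: val_inj; rewrite /= catA.
Qed.

Lemma pcomp_idl x y (u : phom x y) : pcomp (bpath (qnil y)) u = u.
Proof.
apply: (@bpath_ext _ _ _ (fun u => pcomp (bpath (qnil y)) u) id) => // [|p].
  exact: pcomp_linearr.
by rewrite pcompE; congr bpath; apply: val_inj; rewrite /= cats0.
Qed.

Lemma pcomp_idr x y (u : phom x y) : pcomp u (bpath (qnil x)) = u.
Proof.
apply: (@bpath_ext _ _ _ (fun u => pcomp u (bpath (qnil x))) id) => // [|p].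
  exact: pcomp_linearl.
by rewrite pcompE; congr bpath; apply: val_inj.
Qed.

Definition path_cat : kcat k :=
  KCat pcomp_linearl pcomp_linearr pcompA pcomp_idl pcomp_idr.

(* kQ^{>= n} *)
Definition path_ge (n : nat) : ideal path_cat :=
  @gen_ideal k path_cat (fun x y =>
    [set u | exists p : qpath x y, (n <= size p)%N /\ u = bpath p]).

Definition admissible (I : ideal path_cat) : Prop :=
  forall x : vertex Q, exists N : nat, [/\ (0 < N)%N,
    forall y : vertex Q,
      path_ge N x y `<=` I x y /\ I x y `<=` path_ge 2 x y &
    forall y : vertex Q,
      path_ge N y x `<=` I y x /\ I y x `<=` path_ge 2 y x].

Definition path_notin (I : ideal path_cat) (s : seq (arrow Q)) : Prop :=
  exists (x y : vertex Q) (p : qpath x y), qseq p = s /\ ~ I x y (bpath p).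

Definition multiserial_relations (I : ideal path_cat) : Prop :=
  forall a : arrow Q,
    (forall b b', path_notin I [:: a; b] -> path_notin I [:: a; b'] -> b = b') /\
    (forall c c', path_notin I [:: c; a] -> path_notin I [:: c'; a] -> c = c').

End PathCategory.

Definition locally_finite (Q : quiver) : Prop :=
  forall x : vertex Q,
    finite_set [set a : arrow Q | src a = x] /\
    finite_set [set a : arrow Q | tgt a = x].

Definition special_multiserial (k : fieldType) (C : kcat k) : Prop :=
  exists (Q : quiver) (I : ideal (path_cat k Q)),
    [/\ locally_finite Q, admissible I, multiserial_relations I &
        kcat_iso C (quot_cat I)].

Definition special_biserial (k : fieldType) (C : kcat k) : Prop :=
  exists (Q : quiver) (I : ideal (path_cat k Q)),
    [/\ locally_finite Q, admissible I, multiserial_relations I,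
        kcat_iso C (quot_cat I) &
        forall x : vertex Q,
          ([set a : arrow Q | src a = x] #<= `I_2)%card /\
          ([set a : arrow Q | tgt a = x] #<= `I_2)%card].

(* [range C] is a partition of E, and C e is its class containing e *)
Definition partition_classes (E : Type) (C : E -> set E) : Prop :=
  partition (range C) id [set: E] /\ forall e, C e e.

(* The infinite cyclic group G = <g> is (int, +) with g = 1; [act n e] is
   g^n . e. *)
Record fBC := FBC {
  fbE :> Type;
  act : int -> fbE -> fbE;
  act0 : forall e, act 0 e = e;
  actD : forall m n e, act (m + n) e = act m (act n e);
  fbP : fbE -> set fbE;
  fbL : fbE -> set fbE;
  fbP_partition : partition_classes fbP;
  fbL_partition : partition_classes fbL;
  fbd : fbE -> nat;
  fbd_gt0 : forall e, (0 < fbd e)%N;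
  fb1 : forall e, fbL e `<=` fbP e /\ finite_set (fbP e);
  fb2 : forall e1 e2, fbL e1 = fbL e2 -> fbP (act 1 e1) = fbP (act 1 e2);
  fb3 : forall e1 e2, (exists n, act n e1 = e2) -> fbd e1 = fbd e2;
  fb4 : forall e1 e2, fbP e1 = fbP e2 <->
    fbP (act (fbd e1)%:Z e1) = fbP (act (fbd e2)%:Z e2);
  fb5 : forall e1 e2, fbL e1 = fbL e2 <->
    fbL (act (fbd e1)%:Z e1) = fbL (act (fbd e2)%:Z e2);
  fb6 : let word e := rev [seq fbL (act i%:Z e) | i <- iota 0 (fbd e)] in
    forall e h, ~ (infix (word e) (word h) /\ word e <> word h) }.

Definition type_MS (E : fBC) : Prop := forall e : E, fbL e = [set e].

Definition fBG_MS (E : fBC) : Prop :=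
  type_MS E /\ forall e : E, (fbP e #= `I_2)%card.

Section FBCQuiver.
Variable E : fBC.

Definition fb_vertex : Type := set_type (range (@fbP E)).
HB.instance Definition _ := Choice.on fb_vertex.
Definition fb_arrow : Type := set_type (range (@fbL E)).
HB.instance Definition _ := Choice.on fb_arrow.

Definition vtx (e : E) : fb_vertex := SigSub (mem_set (imageT (@fbP E) e)).
Definition arr (e : E) : fb_arrow := SigSub (mem_set (imageT (@fbL E) e)).

Lemma vtx_eq e h : vtx e = vtx h <-> fbP e = fbP h.
Proof. by split => [/(congr1 val)|eh] //; apply: val_inj. Qed.

Lemma arr_eq e h : arr e = arr h <-> fbL e = fbL h.
Proof. by split => [/(congr1 val)|eh] //; apply: val_inj. Qed.

Definition arr_repr (a : fb_arrow) : E := sval (cid2 (set_mem (valP a))).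

Lemma arr_reprK a : arr (arr_repr a) = a.
Proof. by apply: val_inj; rewrite /arr_repr; case: cid2. Qed.

Lemma class_eq (C : E -> set E) e h :
  partition_classes C -> C e h -> C h = C e.
Proof.
move=> [[_ tI _] Cc] eh; apply: (tI (C h) (C e)); try exact: imageT.
by exists h; split => //; exact: Cc.
Qed.

(* Q_E; the values of src and tgt on arr e are given by the two lemmas below *)
Definition fb_quiver : quiver :=
  @Quiver fb_vertex fb_arrow
    (fun a => vtx (arr_repr a)) (fun a => vtx (act 1 (arr_repr a))).

Lemma src_arr e : @src fb_quiver (arr e) = vtx e.
Proof.
apply/vtx_eq/class_eq; first exact: fbP_partition.
apply: (fb1 e).1; have /arr_eq <- := arr_reprK (arr e).
exact: (fbL_partition E).2.
Qed.

Lemma tgt_arr e : @tgt fb_quiver (arr e) = vtx (act 1 e).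
Proof. by apply/vtx_eq/fb2/arr_eq/arr_reprK. Qed.

(* the path L(g^{n-1} e) ... L(g e) L(e) *)
Definition walk (e : E) (n : nat) : seq fb_arrow :=
  [seq arr (act i%:Z e) | i <- iota 0 n].

Lemma walk_qpath e n :
  @is_qpath fb_quiver (vtx e) (vtx (act n%:Z e)) (walk e n).
Proof.
elim: n => [|n IH]; first by rewrite /= act0.
rewrite /walk -addn1 iotaD map_cat; apply: is_qpath_cat IH _.
rewrite add0n; apply/andP; split; apply/eqP; first exact: src_arr.
by apply: etrans (tgt_arr _) _; rewrite -actD PoszD addrC.
Qed.

Variable k : fieldType.
Let kQ : kcat k := path_cat k fb_quiver.

(* By fb1, fb2 and fb4 the two walks are always parallel, so typing them in
   [qpath x y] discards no relation; x = vtx e matters only for trivial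
   walks. *)
Definition fR1 (x y : kQ) : set (hom x y) :=
  [set u | exists (e h : E) (n : nat) (p q : qpath x y),
    [/\ x = vtx e, fbP e = fbP h, (n <= minn (fbd e) (fbd h))%N &
      forall i, (1 <= i <= n)%N ->
        fbL (act (fbd e - i)%N%:Z e) = fbL (act (fbd h - i)%N%:Z h)] /\
    [/\ qseq p = walk e (fbd e - n), qseq q = walk h (fbd h - n) &
        u = bpath k p - bpath k q]].

Definition fR2 (x y : kQ) : set (hom x y) :=
  [set u | exists (n : nat) (e : nat -> E) (p : qpath x y),
    [/\ (1 < n)%N, qseq p = [seq arr (e i) | i <- iota 1 n],
      \bigcap_(i in [set i | (1 <= i <= n)%N])
        (act (n - i)%N%:Z @` fbL (e i)) = set0 &
      u = bpath k p]].

Definition fR3 (x y : kQ) : set (hom x y) :=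
  [set u | exists (e : E) (n : nat) (p : qpath x y),
    [/\ (fbd e < n)%N, qseq p = walk e n & u = bpath k p]].

Arguments fR1 : clear implicits.
Arguments fR2 : clear implicits.
Arguments fR3 : clear implicits.

Definition fb_ideal : ideal kQ :=
  gen_ideal (fun x y : kQ => fR1 x y `|` fR2 x y `|` fR3 x y).

End FBCQuiver.

Definition fb_cat (k : fieldType) (E : fBC) : kcat k := quot_cat (fb_ideal E k).

(* Main.v *)
From HB Require Import structures.
From mathcomp Require Import all_boot all_algebra.
From mathcomp Require Import boolp classical_sets functions cardinality.
From mathcomp.multinomials Require Import freeg.
Require Import Defs.

Set Implicit Arguments.
Unset Strict Implicit.
Unset Printing Implicit Defensive.

Import GRing.Theory.
Local Open Scope ring_scope.

(** Under type MS an arrow of the quiver is an element [e] of the configuration,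
and the only arrow that may follow [e] with a non-zero composite is [nxt e], the
translate of [e] by the generator.  Hence a path survives in the quotient only
if it is a walk [a, nxt a, nxt (nxt a), ...] of length at most [d a]; call it
maximal if its length is [d a].  All maximal walks with the same source [x] are
identified; they end at a common vertex [sigma x], and [sigma] is a bijection of
the vertices because condition [fb4] is an equivalence.

Everything rests on the linear form [soc_form], which sends a maximal walk to 1
and any other path to 0.  It vanishes on the ideal ([soc_vanish]), because every
factor of a maximal walk survives and a maximal walk has no proper maximal
factor.  It therefore defines a pairing of [hom x y] with [hom y (sigma x)],
sending [u] and [v] to the form at the composite of [v] after [u].  Cutting a
maximal walk from [x] at a passage through [y] yields a piece before the cut and
a piece after it.  If the two extreme cuts are made in one chosen walk only, the
first pieces span [hom x y], the second pieces span [hom y (sigma x)], and they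
are dual to each other ([walk_dual_bases]): a first piece of one cut followed by the second piece of another is maximal only if the
cuts agree ([basis_dual]).  One argument thus gives the linear independence of
the surviving paths, the finiteness of the dimensions, and the isomorphisms of
representable functors with duals of representable functors that define a
Frobenius category ([frobenius_of_form]).

Endomorphism rings are local because the coefficient of the trivial path is
multiplicative and long paths vanish: a left ideal that contains an element with
coefficient 1 contains all paths, by descending induction on their length
([aug_left_inverse]).

The defining ideal need not be admissible: an arrow [a] with [d a = 1] is itself
a maximal walk, hence equal to every other maximal walk from its source.  The
remedy is to keep the arrows with [1 < d a] and, at each vertex, one arrow whose
[d] is largest there.  The category does not change ([reduced_iso]), and the
kernel of the new presentation is admissible because [soc_form], applied after
composing with the rest of the maximal walk of a kept arrow, reads off the
coefficient of that arrow ([full_arrow_completion]). *)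

(** * Injections and linear maps *)

Lemma card_le_inj (T U : Type) (f : T -> U) (A : set T) (B : set U) :
  (forall t, A t -> B (f t)) -> injective f -> (A #<= B)%card.
Proof.
move=> AB f_inj; apply: (@card_le_trans _ _ _ (f @` A)%classic).
  have := inj_card_eq (in2W f_inj : {in A &, injective f}).
  by rewrite card_eq_sym => /card_eqPle[].
by apply: subset_card_le => u [t At <-]; exact: AB.
Qed.

Section LinearMaps.
Variables (k : fieldType) (V W : lmodType k) (f : V -> W).
Hypothesis lf : linear f.

Lemma lin0 : f 0 = 0.
Proof.
by have := lf (-1) 0 0; rewrite scaler0 addr0 => {1}->; rewrite scaleN1r addNr.
Qed.

Lemma linD u v : f (u + v) = f u + f v.
Proof. by have := lf 1 u v; rewrite !scale1r. Qed.

Lemma linZ a u : f (a *: u) = a *: f u.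
Proof. by have := lf a u 0; rewrite lin0 !addr0. Qed.

Lemma linB u v : f (u - v) = f u - f v.
Proof. by rewrite -[- v]scaleN1r addrC lf scaleN1r addrC. Qed.

Lemma lin_sum (I : Type) (r : seq I) (P : pred I) (F : I -> V) :
  f (\sum_(i <- r | P i) F i) = \sum_(i <- r | P i) f (F i).
Proof. by elim/big_rec2: _ => [|i y z _ <-]; [exact: lin0 | rewrite linD]. Qed.

End LinearMaps.

Section ToDual.
Variables (k : fieldType) (V W : lmodType k) (B : V -> W -> k^o).
Hypothesis Bl : forall w, linear (B^~ w).
Hypothesis Br : forall v, linear (B v).

Lemma to_dual_subproof v : B v \in @is_linform k W.
Proof. exact/asboolP/Br. Qed.

Definition to_dual_fun v : dual W := Dual (to_dual_subproof v).

Lemma to_dual_linear : linear to_dual_fun.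
Proof. by move=> a u v; apply: dualP => w; rewrite dualE /= Bl. Qed.

HB.instance Definition _ :=
  GRing.isLinear.Build k V (dual W) _ to_dual_fun to_dual_linear.

Definition to_dual : {linear V -> dual W} := to_dual_fun.

Lemma to_dualE v w : to_dual v w = B v w.
Proof. by []. Qed.

End ToDual.

(** A spanning family [b] of [V] and a spanning family [c] of [W] that are dual
for a bilinear form are automatically bases, since the form computes the
coordinates; the form then identifies [V] with the dual of [W]. *)
Section PerfectPairing.
Variables (k : fieldType) (V W : lmodType k) (B : V -> W -> k^o) (n : nat).
Hypothesis Bl : forall w, linear (B^~ w).
Hypothesis Br : forall v, linear (B v).

Definition spans (b : 'I_n -> V) : Prop :=
  forall v, exists c : 'I_n -> k, v = \sum_(i < n) c i *: b i.

Variables (b : 'I_n -> V) (c : 'I_n -> W).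
Hypothesis spanb : spans b.
Hypothesis Bbc : forall i j, B (b i) (c j) = (i == j)%:R.

Lemma pairing_coord (a : 'I_n -> k) j : B (\sum_i a i *: b i) (c j) = a j.
Proof.
rewrite (lin_sum (Bl (c j))) (bigD1 j) //= big1 ?addr0.
  by rewrite (linZ (Bl _)) Bbc eqxx [_ *: _]mulr1.
by move=> i /negbTE ij; rewrite (linZ (Bl _)) Bbc ij [_ *: _]mulr0.
Qed.

Lemma pairing_expand v : v = \sum_i B v (c i) *: b i.
Proof.
have [a Ev] := spanb v; rewrite {1}Ev.
by apply: eq_bigr => i _; rewrite Ev pairing_coord.
Qed.

Lemma pairing_dim : has_dim V n.
Proof.
exists b => v; exists (\row_i B v (c i)); split.
  by rewrite {1}[v]pairing_expand; apply: eq_bigr => i _; rewrite mxE.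
by move=> a ->; apply/rowP => j; rewrite mxE (pairing_coord (a 0)).
Qed.

Hypothesis spanc : forall w, exists a : 'I_n -> k, w = \sum_(i < n) a i *: c i.

Lemma pairing_bij : bijective (to_dual Bl Br).
Proof.
exists (fun l : dual W => \sum_i l (c i) *: b i).
  by move=> v; rewrite [RHS]pairing_expand.
move=> l; apply: dualP => w; rewrite to_dualE; have [a ->] := spanc w.
rewrite (lin_sum (Br _)) (lin_sum (dual_linear l)); apply: eq_bigr => i _.
by rewrite (linZ (Br _)) (linZ (dual_linear l)) pairing_coord.
Qed.

End PerfectPairing.

(** * Frobenius categories and local endomorphism rings *)

Section FrobeniusForm.
Variables (k : fieldType) (C : kcat k) (sigma : C -> C).
Variable lam : forall x : C, hom x (sigma x) -> k^o.
Hypothesis lam_lin : forall x, linear (@lam x).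

(** A non-degenerate form in the shape in which walks provide it: [lam] is a
linear form on each [hom x (sigma x)], and non-degeneracy of the pairing it
induces is witnessed by explicit bases. *)
Definition dual_bases (x y : C) (n : nat) : Prop :=
  exists (u : 'I_n -> hom x y) (v : 'I_n -> hom y (sigma x)),
    [/\ forall i j, lam (comp (v j) (u i)) = (i == j)%:R, spans u & spans v].

Definition form (x y : C) (u : hom x y) (v : hom y (sigma x)) : k^o :=
  lam (comp v u).

Lemma form_linear_left x y v : linear (fun u : hom x y => form u v).
Proof. by move=> a u w; rewrite /form comp_linearr lam_lin. Qed.

Lemma form_linear_right x y u : linear (fun v : hom y (sigma x) => form u v).
Proof. by move=> a v w; rewrite /form comp_linearl lam_lin. Qed.

Lemma dual_bases_sym (n : nat) x y (u : 'I_n -> hom x y) v :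
  (forall i j, form (u i) (v j) = (i == j)%:R) ->
  forall i j, form (u j) (v i) = (i == j)%:R.
Proof. by move=> uv i j; rewrite uv eq_sym. Qed.

Lemma dual_bases_dim x y n :
  dual_bases x y n -> has_dim (hom x y) n /\ has_dim (hom y (sigma x)) n.
Proof.
move=> [u [v [uv su sv]]]; split.
  exact: (pairing_dim (@form_linear_left x y) su uv).
exact: (pairing_dim (B := fun v u => form u v) (@form_linear_right x y) sv
  (dual_bases_sym uv)).
Qed.

Hypothesis sigma_surj : forall y, exists x, sigma x = y.
Hypothesis dualb : forall x y, exists n, dual_bases x y n.

(** Pairing by the form identifies [hom y (sigma x)] with the dual of [hom x y]
and conversely; associativity of composition makes both identifications natural
in [y].  Surjectivity of [sigma] makes every contravariant representable functor
one of those reached. *)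
Lemma frobenius_of_form : frobenius C.
Proof.
move=> x; have [y <-] := sigma_surj x; exists y, (sigma (sigma y)); split.
  exists (fun z => to_dual (B := fun v u => form u v)
    (@form_linear_right y z) (@form_linear_left y z)); split.
    move=> z; have [n [u [v [uv su sv]]]] := dualb y z.
    exact: pairing_bij sv (dual_bases_sym uv) su.
  by move=> z t w v; apply: dualP => u; rewrite !to_dualE /form /= /pre compA.
exists (fun z => to_dual
  (@form_linear_left (sigma y) z) (@form_linear_right (sigma y) z)); split.
  move=> z; have [n [u [v [uv su sv]]]] := dualb (sigma y) z.
  exact: pairing_bij su uv sv.
by move=> z t w v; apply: dualP => u; rewrite !to_dualE /form /= /post compA.
Qed.

End FrobeniusForm.

Section LocalEnd.
Variables (k : fieldType) (C : kcat k) (x : C) (eps : hom x x -> k^o).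
Hypothesis eps_lin : linear eps.
Hypothesis eps_mul : forall w u, eps (comp w u) = eps w * eps u.
Hypothesis eps_id : eps (idc x) = 1.
Hypothesis eps_inv : forall u, eps u = 1 -> exists w, comp w u = idc x.

(** The kernel of [eps] is the maximal left ideal: an element outside it
becomes left invertible after scaling. *)
Lemma local_end_of_augmentation : local_end x.
Proof.
pose J : set (hom x x) := [set u | eps u = 0]%classic.
have JI : end_left_ideal J.
  split => [|u v Ju Jv|w u Ju]; rewrite /J /=.
  - exact: lin0 eps_lin.
  - by rewrite (linD eps_lin) Ju Jv addr0.
  - by rewrite eps_mul Ju mulr0.
have JT : J <> setT.
  move=> JT; have : J (idc x) by rewrite JT.
  by rewrite /J /= eps_id; apply/eqP/oner_neq0.
have Jmax J' : end_left_ideal J' -> J' <> setT -> (J' `<=` J)%classic.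
  move=> [J0 JD JM] JT' u J'u; rewrite /J /=; apply: contrapT => /eqP nz.
  apply: JT'; apply/seteqP; split => // v _.
  pose w := comp ((eps u)^-1 *: idc x) u.
  have [w' w'1] : exists w', comp w' w = idc x.
    apply: eps_inv; rewrite /w eps_mul (linZ eps_lin) eps_id.
    by rewrite [_ *: _]mulr1 mulVf.
  by rewrite -[v]comp_idr -w'1; do 3 apply: (JM).
exists J; split.
  split => // J' J'I JJ' J'T; apply/seteqP; split => //; exact: Jmax.
move=> J' [J'I J'T J'max]; apply: J'max => //; exact: Jmax.
Qed.

End LocalEnd.

(** * Linear combinations of paths *)

Section PathSpan.
Variables (k : fieldType) (Q : quiver).

(** Induction on a linear combination that only looks at the paths with a
non-zero coefficient. *)
Lemma phom_span (x y : vertex Q) (T : phom k x y -> Prop) :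
  T 0 -> (forall a u v, T u -> T v -> T (a *: u + v)) ->
  forall u, (forall p, coeff p u != 0 -> T (bpath k p)) -> T u.
Proof.
move=> T0 TP u Tu; rewrite -[u]freeg_sumE big_seq.
elim/big_rec: _ => // p v p_u Tv.
have -> : << coeff p u *g p >> = coeff p u *: (bpath k p : phom k x y).
  by apply/eqP/freeg_eqP => q; rewrite coeffZ !coeffU mul1r.
by apply: TP => //; apply: Tu; rewrite -mem_dom.
Qed.

Lemma phom_ind (x y : vertex Q) (T : phom k x y -> Prop) :
  T 0 -> (forall a u v, T u -> T v -> T (a *: u + v)) ->
  (forall p, T (bpath k p)) -> forall u, T u.
Proof. by move=> T0 TP Tp u; apply: phom_span. Qed.

(** The linear span of the paths from [x] to [y] of length at least [n],
described by the predicates stable under linear combinations.  Unlike membership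
in [path_ge], it concerns the fixed pair [x], [y] only, so it can be compared
with an ideal that contains the long paths from [x] but not all paths of the
same length elsewhere. *)
Definition span_ge (n : nat) x y : set (@hom k (path_cat k Q) x y) :=
  [set u | forall T : phom k x y -> Prop,
    T 0 -> (forall a v w, T v -> T w -> T (a *: v + w)) ->
    (forall p : qpath x y, (n <= size p)%N -> T (bpath k p)) -> T u]%classic.

Definition span_ideal (n : nat) : ideal (path_cat k Q).
Proof.
apply: (@Ideal k (path_cat k Q) (@span_ge n)) => [x y T|x y a u v Hu Hv T||].
- by [].
- by move=> T0 TP Tp; apply: (TP); [exact: Hu|exact: Hv].
- move=> x y z v u Hu T T0 TP Tp; apply: (Hu (fun u => T (pcomp v u))).
  + by rewrite (lin0 (pcomp_linearr v)).
  + by move=> a w w' Hw Hw'; rewrite pcomp_linearr; exact: TP.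
  move=> p le; elim/phom_ind: v => [|a w w' Hw Hw'|q].
  + by rewrite (lin0 (pcomp_linearl _)).
  + by rewrite pcomp_linearl; exact: TP.
  by rewrite pcompE; apply: Tp; rewrite size_cat (leq_trans le) // leq_addr.
- move=> x y z v u Hv T T0 TP Tp; apply: (Hv (fun v => T (pcomp v u))).
  + by rewrite (lin0 (pcomp_linearl u)).
  + by move=> a w w' Hw Hw'; rewrite pcomp_linearl; exact: TP.
  move=> p le; elim/phom_ind: u => [|a w w' Hw Hw'|q].
  + by rewrite (lin0 (pcomp_linearr _)).
  + by rewrite pcomp_linearr; exact: TP.
  by rewrite pcompE; apply: Tp; rewrite size_cat (leq_trans le) // leq_addl.
Defined.

Lemma path_ge_span n x y u : path_ge k Q n x y u -> @span_ge n x y u.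
Proof.
move=> /(_ (span_ideal n)); apply=> x' y' v [p [le ->]] T _ _; exact.
Qed.

(** The form depends on the underlying sequence of arrows only, so that one
function [f] gives compatible forms for all pairs of vertices. *)
Definition path_form (f : seq (arrow Q) -> k) (x y : vertex Q) :
  phom k x y -> k^o := fglift (fun p : qpath x y => f p : k^o).

Lemma path_form_linear f x y : linear (@path_form f x y).
Proof. exact: fglift_linear. Qed.

Lemma path_formE f x y (p : qpath x y) : path_form f (bpath k p) = f p.
Proof. by rewrite /path_form /bpath liftU scale1r. Qed.

End PathSpan.

(** * Walks along a successor map *)

Section Walks.
Variables (Q : quiver) (nxt prv : arrow Q -> arrow Q) (d : arrow Q -> nat).
Hypothesis nxtK : cancel nxt prv.
Hypothesis prvK : cancel prv nxt.
Hypothesis d_gt0 : forall a, (0 < d a)%N.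
Hypothesis d_nxt : forall a, d (nxt a) = d a.
Hypothesis tgt_nxt : forall a, tgt a = src (nxt a).

Implicit Types (a b : arrow Q) (p q r s t : seq (arrow Q)) (x y z : vertex Q).

(** [full] recognises the maximal walks; [alive] recognises the trivial paths
and the walks that are not too long, that is, the factors of maximal walks. *)
Definition full s : bool :=
  if s is a :: _ then s == traject nxt a (d a) else false.

Definition alive s : bool :=
  if s is a :: _ then (s == traject nxt a (size s)) && (size s <= d a)%N
  else true.

Lemma d_iter n a : d (iter n nxt a) = d a.
Proof. by elim: n => //= n; rewrite d_nxt. Qed.

Lemma d_iter_prv n a : d (iter n prv a) = d a.
Proof. by elim: n => //= n <-; rewrite -[in RHS](prvK (iter n prv a)) d_nxt. Qed.

Lemma iter_nxtK n a : iter n nxt (iter n prv a) = a.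
Proof. by elim: n a => //= n IH a; rewrite -iterS iterSr prvK IH. Qed.

Lemma iter_nxt_inj n : injective (iter n nxt).
Proof. by elim: n => [|n IH] a b //= /(can_inj nxtK)/IH. Qed.

Lemma traject_factor p q r a n :
  p ++ q ++ r = traject nxt a n ->
  q = traject nxt (iter (size p) nxt a) (size q).
Proof.
move=> E; have := congr1 size E; rewrite size_traject !size_cat => En.
move: E; rewrite -En !trajectD => /eqP.
rewrite eqseq_cat ?size_traject // => /andP[_].
by rewrite eqseq_cat ?size_traject // => /andP[/eqP].
Qed.

Lemma full_traject a : full (traject nxt a (d a)).
Proof. by have := d_gt0 a; rewrite /full; case E: (d a) => //= _; rewrite E. Qed.

Lemma fullP s : reflect (exists a, s = traject nxt a (d a)) (full s).
Proof.
apply: (iffP idP) => [|[a ->]]; last exact: full_traject.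
by case: s => // a s /eqP E; exists a.
Qed.

Lemma full_size a s : full (a :: s) -> size (a :: s) = d a.
Proof. by move/eqP ->; rewrite size_traject. Qed.

(** All arrows of a walk lie on one orbit, so any of them determines the length
of the maximal walk. *)
Lemma full_factor_size p a q r :
  full (p ++ (a :: q) ++ r) -> size (p ++ (a :: q) ++ r) = d a.
Proof.
move/fullP => [b E]; rewrite {1}E size_traject.
by have [-> _] := traject_factor E; rewrite d_iter.
Qed.

Lemma full_factor p q r : full (p ++ q ++ r) -> alive q.
Proof.
case: q => // a q F; have sz := full_factor_size F; have [b E] := fullP _ F.
have := traject_factor E; rewrite /alive -sz => Eq; apply/andP; split.
  by case: (Eq) => <- Eq'; rewrite [X in X == _]Eq //=; case: Eq => <-.
by rewrite !size_cat addnCA leq_addr.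
Qed.

Lemma full_head_inj p q a : full (a :: p) -> full (a :: q) -> p = q.
Proof. by move=> /eqP Ep /eqP; rewrite -Ep => -[]. Qed.

(** The first arrow of a maximal walk is obtained from the last one by going
back along the injective map [nxt]. *)
Lemma full_last_inj p q a : full (rcons p a) -> full (rcons q a) -> p = q.
Proof.
have lastE s : full (rcons s a) ->
    exists2 b, s = traject nxt b (d a).-1 & iter (d a).-1 nxt b = a.
  case/fullP => b; have := d_iter (d b).-1 b; have := d_gt0 b.
  case: (d b) => // n _ dn; rewrite trajectSr => /rcons_inj[-> ->].
  by exists b; rewrite dn.
move=> /lastE[b -> lb] /lastE[c -> lc].
by congr traject; apply: (@iter_nxt_inj (d a).-1); rewrite lb lc.
Qed.

(** Both walks have the length [d] of an arrow which they share. *)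
Lemma full_full_factor p q r :
  full (p ++ q ++ r) -> full q -> p = [::] /\ r = [::].
Proof.
case: q => // a q F Fq; have := full_factor_size F.
rewrite -(full_size Fq) !size_cat => E.
suff: (size p + size r == 0)%N by rewrite addn_eq0 !size_eq0 => /andP[/eqP-> /eqP->].
by move: E; rewrite addnCA -[RHS]addn0 => /addnI ->.
Qed.

Lemma alive_fullr s : alive s -> s != [::] -> exists r, full (s ++ r).
Proof.
case: s => // a s /andP[/eqP E le] _.
exists (traject nxt (iter (size (a :: s)) nxt a) (d a - size (a :: s))).
by rewrite {1}E -trajectD subnKC // full_traject.
Qed.

Lemma alive_fulll s : alive s -> s != [::] -> exists r, full (r ++ s).
Proof.
case: s => // a s /andP[/eqP E le] _; set n := size (a :: s) in E le.
pose b := iter (d a - n) prv a; exists (traject nxt b (d a - n)).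
rewrite E -[in X in _ ++ X](iter_nxtK (d a - n) a) -/b -trajectD subnK //.
by rewrite -(d_iter_prv (d a - n) a) full_traject.
Qed.

(** A non-trivial walk is always a path, since the target of an arrow is the
source of its successor. *)
Lemma is_qpath_traject x y a n :
  is_qpath x y (traject nxt a n.+1) =
  (src a == x) && (src (iter n.+1 nxt a) == y).
Proof.
elim: n x a => [|n IH] x a; first by rewrite /= tgt_nxt.
rewrite -[LHS]/((src a == x) && is_qpath (tgt a) y (traject nxt (nxt a) n.+1)).
by rewrite IH tgt_nxt eqxx -iterSr.
Qed.

Lemma is_qpath_tgt x y z s : is_qpath x y s -> is_qpath x z s -> y = z.
Proof.
elim: s x => [|a s IH] x /=; first by move=> /eqP <- /eqP.
by move=> /andP[_ /IH{}IH] /andP[_ /IH].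
Qed.

Hypothesis src_finite : forall x, finite_set [set a : arrow Q | src a = x].
Hypothesis src_surj : forall x, exists a : arrow Q, src a = x.
(* Maximal walks have the same source if and only if they have the same target:
   one direction defines [sigma], the other makes it injective. *)
Hypothesis src_end : forall a b : arrow Q,
  src a = src b <-> src (iter (d a) nxt a) = src (iter (d b) nxt b).

Definition fib x : seq (arrow Q) := sval (cid ((finite_seqP _).1 (src_finite x))).

Lemma mem_fib x a : (a \in fib x) = (src a == x).
Proof.
rewrite /fib; case: cid => s /= /seteqP[Hs sH].
by apply/idP/eqP; [exact: sH|exact: Hs].
Qed.

Lemma rep_subproof x :
  exists r : arrow Q, src r = x /\ forall a, src a = x -> (d a <= d r)%N.
Proof.
have [a ax] := src_surj x.
have [r rP rmax] : exists2 r, r \in fib x & forall b, b \in fib x -> (d b <= d r)%N.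
  have: a \in fib x by rewrite mem_fib ax.
  elim: (fib x) a {ax} => // b s IH a _.
  case: s IH => [_|c s /(_ c (mem_head _ _))[r rs rmax]].
    by exists b; rewrite ?mem_head // => e; rewrite inE => /eqP ->.
  have [le|lt] := leqP (d b) (d r).
    exists r; first by rewrite inE rs orbT.
    by move=> e; rewrite inE => /predU1P[-> //|/rmax].
  exists b; first exact: mem_head.
  move=> e; rewrite inE => /predU1P[-> //|/rmax le].
  exact: leq_trans le (ltnW lt).
exists r; split; first by apply/eqP; rewrite -mem_fib.
by move=> b /eqP; rewrite -mem_fib => /rmax.
Qed.

(** Any arrow from [x] with the largest value of [d]: it fixes a maximal walk
from [x], and its value bounds the length of all surviving paths from [x]. *)
Definition rep x : arrow Q := sval (cid (rep_subproof x)).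

Lemma src_rep x : src (rep x) = x.
Proof. by rewrite /rep; case: cid => r []. Qed.

Lemma rep_max a : (d a <= d (rep (src a)))%N.
Proof. by rewrite /rep; case: cid => r [_] /= ->. Qed.

Definition fullw a : seq (arrow Q) := traject nxt a (d a).

(** The end of all maximal walks from [x].  On objects this is a Nakayama
permutation: the functor [hom - (sigma x)] will be dual to [hom x -]. *)
Definition sigma x : vertex Q := src (iter (d (rep x)) nxt (rep x)).

Lemma sigmaE a : sigma (src a) = src (iter (d a) nxt a).
Proof. by rewrite /sigma; apply: (src_end _ _).1; rewrite src_rep. Qed.

(** Walk back [d a] steps from an arrow [a] starting at [y]. *)
Lemma sigma_surj y : exists x, sigma x = y.
Proof.
have [a <-] := src_surj y; exists (src (iter (d a) prv a)).
by rewrite sigmaE d_iter_prv iter_nxtK.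
Qed.

Lemma fullw_qpath a : is_qpath (src a) (sigma (src a)) (fullw a).
Proof.
rewrite /fullw sigmaE; case: (d a) (d_gt0 a) => // n _.
by rewrite is_qpath_traject !eqxx.
Qed.

Lemma full_qpath x y s : full s -> is_qpath x y s -> y = sigma x.
Proof.
move=> /fullP[a ->]; have /= := fullw_qpath a.
rewrite /fullw; case: (d a) (d_gt0 a) => // n _ Ha Hx.
have/andP[/eqP ax _] :
  (src a == x) && is_qpath (tgt a) y (traject nxt (nxt a) n) by [].
by rewrite -ax; apply: is_qpath_tgt Ha; rewrite ax.
Qed.

Lemma sigma_inj : injective sigma.
Proof.
move=> x y; have [a <-] := src_surj x; have [b <-] := src_surj y.
by rewrite !sigmaE => /(src_end _ _).2.
Qed.

Lemma full_cons_qpath a s :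
  full (a :: s) -> is_qpath (src a) (sigma (src a)) (a :: s).
Proof. by move=> /eqP E; rewrite E; exact: fullw_qpath. Qed.

Lemma is_qpath_catP x z s t : is_qpath x z (s ++ t) ->
  exists2 y, is_qpath x y s & is_qpath y z t.
Proof.
elim: s x => [|a s IH] x /=; first by exists x.
by move=> /andP[-> /IH[y Hs Ht]]; exists y.
Qed.

(** The cuts of the maximal walks from [x], listed without reference to the vertex
at the cut, so that the bases for all vertices can be counted together. *)
Definition pairs x : seq (seq (arrow Q) * seq (arrow Q)) :=
  undup [seq (take n (fullw a), drop n (fullw a))
           | a <- fib x, n <- iota 0 (d a).+1].

(** A cut at an end of a maximal walk gives the trivial path and a socle
element.  As all maximal walks from [x] are equal in the quotient, such a cut is
allowed for one chosen walk only; otherwise the basis elements would repeat. *)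
Definition dual_pair x (st : seq (arrow Q) * seq (arrow Q)) : bool :=
  full (st.1 ++ st.2) &&
  ((st.1 == [::]) || (st.2 == [::]) ==> (st.1 ++ st.2 == fullw (rep x))).

Definition basis x y : seq (seq (arrow Q) * seq (arrow Q)) :=
  [seq st <- pairs x |
     [&& dual_pair x st, is_qpath x y st.1 & is_qpath y (sigma x) st.2]].

Lemma mem_basis x y st : (st \in basis x y) =
  [&& dual_pair x st, is_qpath x y st.1 & is_qpath y (sigma x) st.2].
Proof.
rewrite mem_filter andb_idr // => /and3P[/andP[/fullP[a E] _] p1 p2].
have := is_qpath_cat p1 p2; have szE := congr1 size E.
rewrite E; case Ed: (d a) (d_gt0 a) => [//|n] _.
rewrite is_qpath_traject => /andP[ax _].
rewrite mem_undup; apply/allpairsPdep; exists a, (size st.1); split.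
- by rewrite mem_fib.
- by rewrite mem_iota /= add0n ltnS -(size_traject nxt a (d a)) -E size_cat leq_addr.
- by rewrite /fullw -E take_size_cat // drop_size_cat //; case: (st).
Qed.

Lemma basis_uniq x y : uniq (basis x y).
Proof. exact/filter_uniq/undup_uniq. Qed.

(** Two maximal walks that share the first or the last arrow are equal.  So a
first piece [s] and a second piece [t'] can only be joined if they come from the
same walk; for a trivial piece, the choice of one walk in [dual_pair] decides. *)
Lemma basis_dual x y st st' : st \in basis x y -> st' \in basis x y ->
  full (st.1 ++ st'.2) = (st == st').
Proof.
rewrite !mem_basis => /and3P[/andP[F1 D1] _ _] /and3P[/andP[F2 D2] _ _].
apply/idP/eqP => [|<-//].
case: st st' F1 D1 F2 D2 => [s t] [s' t'] /= F1 D1 F2 D2 F.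
have [s0|sN] := eqVneq s [::].
  move: D1 F; rewrite s0 /= => /eqP -> F.
  have F2' : full (s' ++ t' ++ [::]) by rewrite cats0.
  have [s'0 _] := full_full_factor F2' F.
  by move: D2; rewrite s'0 /= => /eqP ->.
have [t0|tN] := eqVneq t' [::].
  move: D2 F; rewrite t0 orbT cats0 /= => /eqP -> F.
  move: F D1 F1; rewrite cats0 => F D1 /(full_full_factor (p := [::]))/(_ F)[_ t1].
  by move: D1; rewrite t1 orbT cats0 => /eqP ->.
have -> : t = t'.
  case: s sN F F1 {D1} => // a s _ F F1; have := full_head_inj F F1.
  by move/(congr1 (drop (size s))); rewrite !drop_size_cat.
congr (_, _); case/lastP: t' tN F F2 {D2} => // t' a _.
rewrite -!rcons_cat => F F2; have := full_last_inj F F2.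
move=> E; have := congr1 size E; rewrite !size_cat => /addIn sz.
by move: E => /eqP; rewrite eqseq_cat // => /andP[/eqP].
Qed.

(** A sequence of arrows from [x] is a path to one vertex at most, so the bases
for different targets are disjoint parts of [pairs x]. *)
Lemma basis_bound x n (y : 'I_n -> vertex Q) : injective y ->
  (\sum_(i < n) size (basis x (y i)) <= size (pairs x))%N.
Proof.
move=> y_inj; rewrite /basis.
under eq_bigr do rewrite size_filter.
elim: (pairs x) => [|st l IH]; first by rewrite big1.
rewrite /= big_split /= -add1n leq_add //.
have [/existsP[i Pi]|/existsPn N] := boolP [exists i, is_qpath x (y i) st.1].
  rewrite (bigD1 i) //= big1 ?addn0 ?leq_b1 // => j ji.
  apply/eqP; rewrite eqb0; apply/negP => /and3P[_ Pj _].
  by case/eqP: ji; apply: y_inj; apply: is_qpath_tgt Pj Pi.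
by rewrite big1 // => i _; rewrite (negbTE (N i)) andbF.
Qed.

(** A non-trivial surviving path extends to a maximal walk on the right, which
gives the cut of which it is the first piece; a path that is maximal itself is
replaced by the chosen maximal walk. *)
Lemma basis_span_left x y s : is_qpath x y s -> alive s ->
  exists2 st, st \in basis x y & s = st.1 \/ (full s /\ full st.1).
Proof.
move=> p al; have fx := full_traject (rep x); have px := fullw_qpath (rep x).
rewrite src_rep in px.
have [s0|sN] := eqVneq s [::].
  move: p; rewrite s0 => /eqP <-; exists ([::], fullw (rep x)); last by left.
  by rewrite mem_basis /dual_pair /= fx !eqxx.
have [F|NF] := boolP (full s).
  rewrite (full_qpath F p); exists (fullw (rep x), [::]); last by right.
  by rewrite mem_basis /dual_pair /= cats0 fx px !eqxx orbT.
have [r Fr] := alive_fullr al sN.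
have rN : r != [::] by apply: contra NF => /eqP r0; rewrite -[s]cats0 -r0.
exists (s, r); last by left.
rewrite mem_basis /dual_pair /= Fr (negbTE sN) (negbTE rN) p /=.
case: s sN p Fr {al NF} => // a s _ p Fr; have := full_cons_qpath Fr.
have /andP[/eqP -> _] : (src a == x) && is_qpath (tgt a) y s by [].
by move=> /(@is_qpath_catP _ _ (a :: s))[z /(is_qpath_tgt p) ->].
Qed.

(** Extending on the left produces a maximal walk from some vertex to [sigma x];
that vertex is [x] because [sigma] is injective. *)
Lemma basis_span_right x y t : is_qpath y (sigma x) t -> alive t ->
  exists2 st, st \in basis x y & t = st.2 \/ (full t /\ full st.2).
Proof.
move=> p al; have fx := full_traject (rep x); have px := fullw_qpath (rep x).
rewrite src_rep in px.
have [t0|tN] := eqVneq t [::].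
  move: p; rewrite t0 => /eqP ->; exists (fullw (rep x), [::]); last by left.
  by rewrite mem_basis /dual_pair /= cats0 fx px !eqxx orbT.
have [F|NF] := boolP (full t).
  have /sigma_inj <- := full_qpath F p.
  exists ([::], fullw (rep x)); last by right.
  by rewrite mem_basis /dual_pair /= fx px !eqxx.
have [r Fr] := alive_fulll al tN.
have rN : r != [::] by apply: contra NF => /eqP r0; rewrite -[t]cat0s -r0.
exists (r, t); last by left.
rewrite mem_basis /dual_pair /= Fr (negbTE tN) (negbTE rN) p /=.
case: r rN Fr => // a r _ Fr.
have [z p1 p2] := is_qpath_catP (s := a :: r) (full_cons_qpath Fr).
have zy : z = y.
  case: t tN p p2 {al NF Fr} => // b t _.
  move=> /(fun h => h : is_true ((src b == y) && is_qpath (tgt b) (sigma x) t)).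
  move=> /andP[/eqP <- _].
  move=> /(fun h => h : is_true ((src b == z) && is_qpath (tgt b) _ t)).
  by move=> /andP[/eqP ->].
rewrite zy in p1 p2; have /sigma_inj ax := is_qpath_tgt p2 p.
by rewrite -ax p1.
Qed.

(** * The quotient by the relations between walks *)

Section MaximalWalkAlgebra.
Variables (k : fieldType) (I : ideal (path_cat k Q)).
(* The three hypotheses say that [I] is the ideal generated by the paths that
   are not [alive] and the differences of parallel maximal walks. *)
Hypothesis I_dead : forall x y (p : qpath x y), ~~ alive p -> I x y (bpath k p).
Hypothesis I_full : forall x y (p q : qpath x y),
  full p -> full q -> I x y (bpath k p - bpath k q).
Hypothesis I_min : forall J : ideal (path_cat k Q),
  (forall x y (p : qpath x y), ~~ alive p -> J x y (bpath k p)) ->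
  (forall x y (p q : qpath x y), full p -> full q ->
     J x y (bpath k p - bpath k q)) ->
  forall x y u, I x y u -> J x y u.

Local Notation Lam := (quot_cat I).

Definition cls x y (p : qpath x y) : @hom k Lam x y := qclass I (bpath k p).

Lemma cls_dead x y (p : qpath x y) : ~~ alive p -> cls p = 0.
Proof.
move=> dp; rewrite -(lin0 (@qclass_linear _ _ I x y)).
by apply/qclassP; rewrite subr0; exact: I_dead.
Qed.

Lemma cls_full x y (p q : qpath x y) : full p -> full q -> cls p = cls q.
Proof. by move=> fp fq; apply/qclassP/I_full. Qed.

Lemma cls_cat x y z (q : qpath y z) (p : qpath x y) :
  comp (cls q) (cls p) = cls (qcat q p).
Proof. by rewrite [LHS]/= /cls qcompE [comp _ _]/= pcompE. Qed.

Section Descent.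
Variables (x y : vertex Q) (f : phom k x y -> k^o).
Hypothesis f_lin : linear f.
Hypothesis f0 : forall u, I x y u -> f u = 0.

Definition descend (u : @hom k Lam x y) : k^o := f (quot_repr u).

Lemma descendE u : descend (qclass I u) = f u.
Proof.
apply/eqP; rewrite -subr_eq0 -(linB f_lin); apply/eqP/f0/qclassP.
exact: quot_reprK.
Qed.

Lemma descend_linear : linear descend.
Proof.
move=> a u v; have [u' <-] := qclass_surj u; have [v' <-] := qclass_surj v.
by rewrite -qclass_linear !descendE f_lin.
Qed.

End Descent.

Definition soc_form x y := path_form (fun s => (full s)%:R : k) (x := x) (y := y).

(** The largest ideal on which [soc_form] vanishes. *)
Definition soc_ker x y : set (@hom k (path_cat k Q) x y) :=
  [set u | forall w z (a : phom k w x) (b : phom k y z),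
     soc_form (pcomp b (pcomp u a)) = 0]%classic.

Lemma soc_form_linear x y : linear (@soc_form x y).
Proof. exact: path_form_linear. Qed.

Definition soc_ideal : ideal (path_cat k Q).
Proof.
apply: (@Ideal k (path_cat k Q) soc_ker).
- move=> x y w z a b.
  rewrite (lin0 (pcomp_linearl a)) (lin0 (pcomp_linearr b)).
  exact: lin0 (@soc_form_linear _ _).
- move=> x y c u v Hu Hv w z a b.
  by rewrite pcomp_linearl pcomp_linearr soc_form_linear Hu Hv scaler0 addr0.
- by move=> x y z v u Hu w t a b; rewrite -pcompA pcompA Hu.
- by move=> x y z v u Hv w t a b; rewrite -pcompA Hv.
Defined.

Lemma soc_kerP x y (u : phom k x y) :
  (forall w z (a : qpath w x) (b : qpath y z),
     soc_form (pcomp (bpath k b) (pcomp u (bpath k a))) = 0) -> soc_ker u.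
Proof.
move=> H w z a b; elim/phom_ind: b => [|c v v' Hv Hv'|b].
- by rewrite (lin0 (pcomp_linearl _)) (lin0 (@soc_form_linear _ _)).
- by rewrite pcomp_linearl soc_form_linear Hv Hv' scaler0 addr0.
elim/phom_ind: a => [|c v v' Hv Hv'|a]; last exact: H.
- by rewrite !(lin0 (pcomp_linearr _)) (lin0 (@soc_form_linear _ _)).
- by rewrite !pcomp_linearr soc_form_linear Hv Hv' scaler0 addr0.
Qed.

Lemma full_exchange p q r s : full q -> full r ->
  full (p ++ q ++ s) = full (p ++ r ++ s).
Proof.
have H q' r' : full q' -> full r' -> full (p ++ q' ++ s) -> full (p ++ r' ++ s).
  by move=> fq fr F; have [-> ->] := full_full_factor F fq; rewrite cats0.
by move=> fq fr; apply/idP/idP; exact: H.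
Qed.

(** It is enough to see that the generators lie in [soc_ker].  A maximal walk
cannot contain a path that is not alive, and it contains a maximal walk only as a
whole, in which case it may be exchanged for any parallel one. *)
Lemma soc_vanish x y u : I x y u -> soc_form u = 0.
Proof.
move=> Iu; have: soc_ideal x y u.
  apply: I_min Iu => {x y u} [x y p dp|x y p q fp fq]; apply: soc_kerP => w z a b.
    rewrite !pcompE /soc_form path_formE /=.
    rewrite -catA; case: (full _) (@full_factor a p b) => // /(_ isT).
    by rewrite (negbTE dp).
  rewrite (linB (pcomp_linearl _)) (linB (pcomp_linearr _)).
  rewrite (linB (@soc_form_linear _ _)).
  rewrite !pcompE /soc_form !path_formE /= -!catA.
  by rewrite (full_exchange _ _ fp fq) subrr.
by move/(_ _ _ (bpath k (qnil x)) (bpath k (qnil y))); rewrite pcomp_idl pcomp_idr.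
Qed.

Definition aug_form x y := path_form (fun s => (s == [::])%:R : k) (x := x) (y := y).

Lemma aug_form_linear x y : linear (@aug_form x y).
Proof. exact: path_form_linear. Qed.

(** A composite of paths is trivial if and only if both paths are. *)
Lemma aug_form_comp x y z (v : phom k y z) (u : phom k x y) :
  aug_form (pcomp v u) = aug_form v * aug_form u.
Proof.
elim/phom_ind: v => [|c v v' Hv Hv'|q].
- by rewrite (lin0 (pcomp_linearl _)) !(lin0 (@aug_form_linear _ _)) mul0r.
- by rewrite pcomp_linearl !aug_form_linear Hv Hv' mulrDl -mulrA.
elim/phom_ind: u => [|c v v' Hv Hv'|p].
- by rewrite (lin0 (pcomp_linearr _)) !(lin0 (@aug_form_linear _ _)) mulr0.
- by rewrite pcomp_linearr !aug_form_linear Hv Hv' mulrDr -[c *: _]/(c * _) mulrCA.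
rewrite pcompE /aug_form !path_formE /=.
by case: (qseq p) => [|a s]; rewrite /= ?mulr1 ?mulr0.
Qed.

Definition aug_ideal : ideal (path_cat k Q).
Proof.
apply: (@Ideal k (path_cat k Q) (fun x y => [set u | @aug_form x y u = 0]%classic)).
- by move=> x y; exact: lin0 (@aug_form_linear _ _).
- by move=> x y c u v /= Hu Hv; rewrite aug_form_linear Hu Hv scaler0 addr0.
- by move=> x y z v u /= Hu; rewrite aug_form_comp Hu mulr0.
- by move=> x y z v u /= Hv; rewrite aug_form_comp Hv mul0r.
Defined.

Lemma aug_vanish x y u : I x y u -> aug_form u = 0.
Proof.
apply: (I_min (J := aug_ideal)) => {x y u} [x y p|x y p q] /=.
  by rewrite /aug_form path_formE; case: (qseq p).
rewrite (linB (@aug_form_linear _ _)) /aug_form !path_formE.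
by case: (qseq p) (qseq q) => // a s [] // b t _ _; rewrite subrr.
Qed.

Definition soc_qform x y := descend (@soc_form x y).
Definition aug_qform x y := descend (@aug_form x y).

Lemma soc_qformE x y (p : qpath x y) : soc_qform (cls p) = (full p)%:R.
Proof.
rewrite /soc_qform descendE ?/soc_form ?path_formE //.
  exact: soc_form_linear.
exact: soc_vanish.
Qed.

Lemma soc_qform_linear x y : linear (@soc_qform x y).
Proof. by apply: descend_linear; [exact: soc_form_linear|exact: soc_vanish]. Qed.

Lemma aug_qform_qclass x y u : @aug_qform x y (qclass I u) = aug_form u.
Proof. by apply: descendE; [exact: aug_form_linear|exact: aug_vanish]. Qed.

Lemma aug_qform_linear x y : linear (@aug_qform x y).
Proof. by apply: descend_linear; [exact: aug_form_linear|exact: aug_vanish]. Qed.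

Lemma aug_qform_comp x y z (v : @hom k Lam y z) (u : @hom k Lam x y) :
  aug_qform (comp v u) = aug_qform v * aug_qform u.
Proof.
have [v' <-] := qclass_surj v; have [u' <-] := qclass_surj u.
by rewrite [comp _ _]/= qcompE !aug_qform_qclass aug_form_comp.
Qed.

Lemma aug_qform_id x : aug_qform (idc (x : Lam)) = 1.
Proof. by rewrite [idc _]/= aug_qform_qclass /aug_form path_formE. Qed.

(** * Dual bases *)

(** Taking the class of a sequence of arrows, with value 0 when it is not a path
from [x] to [y], avoids carrying proofs through the lists of basis elements. *)
Definition seqcls x y s : @hom k Lam x y :=
  if insub s is Some p then cls p else 0.

Lemma seqcls_path x y (p : qpath x y) : seqcls x y p = cls p.
Proof. by rewrite /seqcls (valK p). Qed.

Lemma seqclsE x y s (p : is_qpath x y s) : seqcls x y s = cls (QPath p).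
Proof. exact: (seqcls_path (QPath p)). Qed.

Lemma spans_of_paths x y n (b : 'I_n -> @hom k Lam x y) :
  (forall p : qpath x y, cls p = 0 \/ exists i, cls p = b i) -> spans b.
Proof.
move=> H w; have [u <-] := qclass_surj w.
elim/phom_ind: u => [|c u v [cu Eu] [cv Ev]|p].
- exists (fun=> 0); rewrite (lin0 (@qclass_linear _ _ I x y)) big1 // => i _.
  by rewrite scale0r.
- exists (fun i => c * cu i + cv i); rewrite qclass_linear Eu Ev scaler_sumr.
  by rewrite -big_split; apply: eq_bigr => i _; rewrite scalerDl scalerA.
case: (H p) => [|[i]]; rewrite /cls => ->.
  by exists (fun=> 0); rewrite big1 // => j _; rewrite scale0r.
exists (fun j => (j == i)%:R); rewrite (bigD1 i) //= eqxx scale1r big1 ?addr0 //.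
by move=> j /negbTE ->; rewrite scale0r.
Qed.

(** The two pieces of the cuts at [y] are the dual bases: they span because every
surviving path is a piece of a maximal walk, and the form on a composite of
pieces is given by [basis_dual]. *)
Lemma walk_dual_bases x y :
  @dual_bases k Lam sigma (fun z => @soc_qform z (sigma z)) x y (size (basis x y)).
Proof.
pose st (i : 'I_(size (basis x y))) := nth ([::], [::]) (basis x y) i.
have st_in i : st i \in basis x y by rewrite mem_nth.
exists (fun i => seqcls x y (st i).1), (fun i => seqcls y (sigma x) (st i).2); split.
- move=> i j; have := st_in i; have := st_in j.
  rewrite !mem_basis => /and3P[_ _ pj] /and3P[_ pi _].
  rewrite (seqclsE pi) (seqclsE pj) cls_cat soc_qformE /=.
  rewrite (basis_dual (st_in i) (st_in j)).
  by rewrite nth_uniq ?basis_uniq.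
- apply: spans_of_paths => p.
  have [al|] := boolP (alive p); last by move/cls_dead; left.
  have [e e_in E] := basis_span_left (qseqP p) al.
  right; exists (Ordinal (etrans (index_mem e _) e_in)); rewrite /st nth_index //.
  move: e_in; rewrite mem_basis => /and3P[_ pe _]; rewrite (seqclsE pe).
  case: E => [E|[fp fe]]; last exact: cls_full.
  by congr cls; apply: val_inj.
- apply: spans_of_paths => p.
  have [al|] := boolP (alive p); last by move/cls_dead; left.
  have [e e_in E] := basis_span_right (qseqP p) al.
  right; exists (Ordinal (etrans (index_mem e _) e_in)); rewrite /st nth_index //.
  move: e_in; rewrite mem_basis => /and3P[_ _ pe]; rewrite (seqclsE pe).
  case: E => [E|[fp fe]]; last exact: cls_full.
  by congr cls; apply: val_inj.
Qed.

Lemma walk_frobenius : frobenius Lam.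
Proof.
apply: (@frobenius_of_form k Lam sigma (fun z => @soc_qform z (sigma z))).
- by move=> x; exact: soc_qform_linear.
- exact: sigma_surj.
- by move=> x y; exists (size (basis x y)); exact: walk_dual_bases.
Qed.

(** * Local boundedness *)

Lemma long_dead x y (p : qpath x y) : (d (rep x) < size p)%N -> ~~ alive p.
Proof.
case: p => -[|a s] //= /andP[/eqP <- _] lt; rewrite /alive negb_and -ltnNge.
by apply/orP; right; apply: leq_ltn_trans lt; exact: rep_max.
Qed.

(** A morphism without a component along a trivial path is a combination of
non-trivial paths. *)
Lemma aug_split x y (T : @hom k Lam x y -> Prop) :
  T 0 -> (forall (c : k) u v, T u -> T v -> T (c *: u + v)) ->
  (forall p : qpath x y, qseq p != [::] -> T (cls p)) ->
  forall u, aug_qform u = 0 -> T u.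
Proof.
move=> T0 TP Tp u; have [u' <-] := qclass_surj u; rewrite aug_qform_qclass => u0.
apply: (@phom_span k Q x y (fun u => T (qclass I u))) => [|a v w Tv Tw|p nz].
- by rewrite (lin0 (@qclass_linear _ _ I x y)).
- by rewrite qclass_linear; exact: TP.
apply: Tp; apply: contraNneq nz => p0; rewrite -u0 /aug_form /path_form /coeff.
have -> : (fun q : qpath x y => (qseq q == [::])%:R : k^o) =
          (fun q : qpath x y => (q == p)%:R).
  by apply/funext => q; rewrite -val_eqE /= p0.
exact/eqP.
Qed.

(** Every path [p] is a left multiple of [u], by descending induction on its
length.  Indeed [p] times [u] is [p] plus a combination of longer paths, because
[u] is the identity plus a combination of non-trivial paths; and paths longer
than [d (rep x)] vanish.  The claim for the trivial path is the result. *)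
Lemma aug_left_inverse x (u : @hom k Lam x x) :
  aug_qform u = 1 -> exists w, comp w u = idc (x : Lam).
Proof.
move=> u1.
have dec : aug_qform (u - idc (x : Lam)) = 0.
  by rewrite (linB (@aug_qform_linear _ _)) u1 aug_qform_id subrr.
suff H m (p : qpath x x) : (d (rep x) < size p + m)%N -> exists w, comp w u = cls p.
  by have [|w Ew] := H (d (rep x)).+1 (qnil x); [rewrite /= add0n | exists w].
(* [m] bounds how many arrows [p] lacks to be longer than every surviving path. *)
elim: m p => [|m IH] p lt.
  exists 0; rewrite (lin0 (comp_linearl u)) cls_dead //.
  by apply: long_dead; rewrite addn0 in lt.
have [w Ew] : exists w, comp w u = comp (cls p) (u - idc (x : Lam)).
  move: dec; apply: (aug_split (T := fun v => exists w, comp w u = comp (cls p) v)).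
  - by exists 0; rewrite (lin0 (comp_linearl u)) (lin0 (comp_linearr (cls p))).
  - move=> a v v' [w Ew] [w' Ew']; exists (a *: w + w').
    by rewrite comp_linearl comp_linearr Ew Ew'.
  move=> q qN; rewrite cls_cat; apply: IH.
  rewrite /= size_cat; apply: leq_trans lt _.
  by rewrite addnS -addSn leq_add2r -addn1 addnC leq_add2r lt0n size_eq0.
exists (cls p - w); rewrite (linB (comp_linearl u)) Ew (linB (comp_linearr (cls p))).
by rewrite comp_idr opprB addrCA subrr addr0.
Qed.

Lemma aug_neq x y (u : @hom k Lam x y) : aug_qform u != 0 -> x = y.
Proof.
move=> nz; apply: contrapT => xy; case/eqP: nz; have [u' <-] := qclass_surj u.
rewrite aug_qform_qclass; elim/phom_ind: u' => [|c v v' Hv Hv'|p].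
- exact: lin0 (@aug_form_linear _ _).
- by rewrite aug_form_linear Hv Hv' scaler0 addr0.
rewrite /aug_form path_formE; case: p => -[|a s] //= p.
by case: xy; apply/eqP.
Qed.

(** The bounds on incoming dimensions are those on outgoing ones: [hom y x] is
dual to [hom w y] when [x] is [sigma w]. *)
Lemma walk_locally_bounded : locally_bounded Lam.
Proof.
have dims x y := @dual_bases_dim k Lam sigma _
  (fun z => @soc_qform_linear z (sigma z)) x y _ (walk_dual_bases x y).
split=> [x|x y [u [v [vu _]]]|x].
- apply: (@local_end_of_augmentation k Lam x (@aug_qform x x)).
  + exact: aug_qform_linear.
  + exact: aug_qform_comp.
  + exact: aug_qform_id.
  + exact: aug_left_inverse.
- apply: (@aug_neq x y u); apply/eqP => u0; have := aug_qform_id x.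
  by rewrite -vu aug_qform_comp u0 mulr0 => /esym/eqP; rewrite oner_eq0.
split; first exists (fun y => size (basis x y)).
  split=> [y|]; first exact: (dims x y).1.
  by exists (size (pairs x)) => n y; exact: basis_bound.
have [w <-] := sigma_surj x; exists (fun y => size (basis w y)).
split=> [y|]; first exact: (dims w y).2.
by exists (size (pairs w)) => n y; exact: basis_bound.
Qed.

(** * A presentation by an admissible ideal *)

(** If [d a = 1], then [a] is itself maximal, so it equals the maximal walk of
[rep (src a)] in the quotient: it is superfluous unless it is that arrow. *)
Definition keep a : bool := (1 < d a)%N || (a == rep (src a)).

Definition reduced_quiver : quiver :=
  @Quiver (vertex Q) {a : arrow Q | keep a}
    (fun e => src (val e)) (fun e => tgt (val e)).

Local Notation Q' := reduced_quiver.

Lemma is_qpath_incl x y (s : seq (arrow Q')) :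
  is_qpath x y (map val s) = @is_qpath Q' x y s.
Proof. by elim: s x => //= a s IH x; rewrite IH. Qed.

Lemma incl_subproof x y (p : @qpath Q' x y) : @is_qpath Q x y (map val p).
Proof. by rewrite is_qpath_incl qseqP. Qed.

Definition incl x y (p : @qpath Q' x y) : @qpath Q x y := QPath (incl_subproof p).

Definition incl_lin x y : phom k (Q := Q') x y -> phom k (Q := Q) x y :=
  fglift (fun p : @qpath Q' x y => bpath k (incl p)).

Lemma incl_lin_linear x y : linear (@incl_lin x y).
Proof. exact: fglift_linear. Qed.

Lemma incl_linE x y (p : @qpath Q' x y) : incl_lin (bpath k p) = bpath k (incl p).
Proof. by rewrite /incl_lin /bpath liftU scale1r. Qed.

Lemma incl_lin_comp x y z (v : phom k (Q := Q') y z) (u : phom k (Q := Q') x y) :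
  incl_lin (pcomp v u) = pcomp (incl_lin v) (incl_lin u).
Proof.
elim/phom_ind: v => [|c v v' Hv Hv'|q].
- rewrite (lin0 (pcomp_linearl _)) !(lin0 (@incl_lin_linear _ _)).
  by rewrite (lin0 (pcomp_linearl _)).
- by rewrite pcomp_linearl !incl_lin_linear pcomp_linearl Hv Hv'.
elim/phom_ind: u => [|c v v' Hv Hv'|p].
- rewrite (lin0 (pcomp_linearr _)) !(lin0 (@incl_lin_linear _ _)).
  by rewrite (lin0 (pcomp_linearr _)).
- by rewrite pcomp_linearr !incl_lin_linear pcomp_linearr Hv Hv'.
rewrite pcompE !incl_linE pcompE; congr bpath.
by apply: val_inj; rewrite /= map_cat.
Qed.

Definition reduced_ideal : ideal (path_cat k Q').
Proof.
apply: (@Ideal k (path_cat k Q') (fun x y => [set u | I x y (incl_lin u)]%classic)).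
- by move=> x y /=; rewrite (lin0 (@incl_lin_linear _ _)); exact: ideal0.
- by move=> x y c u v /= Hu Hv; rewrite incl_lin_linear; exact: idealP.
- by move=> x y z v u /= Hu; rewrite incl_lin_comp; exact: (ideal_compl I).
- by move=> x y z v u /= Hv; rewrite incl_lin_comp; exact: (ideal_compr I).
Defined.

Local Notation I' := reduced_ideal.

Definition of_reduced x y (u : phom k (Q := Q') x y) : @hom k Lam x y :=
  qclass I (incl_lin u).

Lemma of_reduced_linear x y : linear (@of_reduced x y).
Proof. by move=> c u v; rewrite /of_reduced incl_lin_linear qclass_linear. Qed.

Lemma of_reduced_eq x y (u v : phom k (Q := Q') x y) :
  of_reduced u = of_reduced v <-> qclass I' u = qclass I' v.
Proof. by rewrite /of_reduced !qclassP /= (linB (@incl_lin_linear x y)). Qed.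

Lemma lift_kept s : all keep s -> exists s' : seq (arrow Q'), map val s' = s.
Proof.
elim: s => [|a s IH] /=; first by exists [::].
by move=> /andP[ka /IH[s' <-]]; exists (exist _ a ka :: s').
Qed.

Lemma of_reduced_kept x y (p : qpath x y) :
  all keep p -> exists u, of_reduced u = cls p.
Proof.
move=> /lift_kept[s Es].
have ps : @is_qpath Q' x y s by rewrite -is_qpath_incl Es qseqP.
exists (bpath k (QPath ps)); rewrite /of_reduced incl_linE.
congr (qclass I (bpath k _)).
exact: val_inj.
Qed.

Lemma keep_traject a n : (1 < d a)%N -> all keep (traject nxt a n).
Proof. by move=> lt; apply/allP => b /trajectP[i _ ->]; rewrite /keep d_iter lt. Qed.

Lemma keep_rep x : all keep (fullw (rep x)).
Proof.
have [lt|] := ltnP 1 (d (rep x)); first exact: keep_traject.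
rewrite /fullw; case: (d _) (d_gt0 (rep x)) => // -[] // _ _ /=.
by rewrite /keep src_rep eqxx orbT.
Qed.

(** A surviving path with an arrow that is not kept consists of this arrow only,
and is maximal; the chosen maximal walk from the same vertex consists of kept
arrows and has the same class. *)
Lemma of_reduced_surj x y (w : @hom k Lam x y) : exists u, of_reduced u = w.
Proof.
have [u <-] := qclass_surj w; elim/phom_ind: u => [|c u v [u' Eu] [v' Ev]|p].
- by exists 0; rewrite /of_reduced (lin0 (@incl_lin_linear x y)).
- by exists (c *: u' + v'); rewrite of_reduced_linear Eu Ev qclass_linear.
have [al|/cls_dead] := boolP (alive p); last first.
  by rewrite -/(cls p) => ->; exists 0; rewrite (lin0 (@of_reduced_linear _ _)).
have [K|NK] := boolP (all keep p); first exact: of_reduced_kept.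
have fp : full p.
  move: al NK; case: (qseq p) => // a s /andP[/eqP E le].
  have [lt|d1] := ltnP 1 (d a); first by rewrite E keep_traject.
  move=> _; rewrite E (_ : size _ = d a) ?full_traject //.
  by apply/eqP; rewrite eqn_leq le (leq_trans d1).
(* Being maximal, [p] ends at [sigma x], as does the chosen walk. *)
have pr : is_qpath x y (fullw (rep x)).
  by rewrite (full_qpath fp (qseqP p)); have := fullw_qpath (rep x); rewrite src_rep.
have [u Eu] := of_reduced_kept (p := QPath pr) (keep_rep x).
by exists u; rewrite Eu; apply: cls_full => //; exact: full_traject.
Qed.

(** The inverse of the map that [of_reduced] induces on the quotient by its
kernel. *)
Definition to_reduced x y (w : @hom k Lam x y) : @hom k (quot_cat I') x y :=
  qclass I' (sval (cid (of_reduced_surj w))).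

Lemma to_of_reduced x y (u : phom k (Q := Q') x y) :
  to_reduced (of_reduced u) = qclass I' u.
Proof. by apply/of_reduced_eq; case: cid. Qed.

Lemma to_reduced_linear x y : linear (@to_reduced x y).
Proof.
move=> c v w; have [v' <-] := of_reduced_surj v; have [w' <-] := of_reduced_surj w.
by rewrite -of_reduced_linear !to_of_reduced qclass_linear.
Qed.

HB.instance Definition _ x y :=
  GRing.isLinear.Build k (@hom k Lam x y) (@hom k (quot_cat I') x y) _
    (@to_reduced x y) (@to_reduced_linear x y).

Lemma to_reduced_bij x y : bijective (@to_reduced x y).
Proof.
exists (fun q : @hom k (quot_cat I') x y => of_reduced (quot_repr q)).
  move=> w; have [u <-] := of_reduced_surj w; rewrite to_of_reduced.
  by apply/of_reduced_eq; exact: quot_reprK.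
by move=> q; rewrite to_of_reduced; exact: quot_reprK.
Qed.

Lemma to_reduced_id x : to_reduced (idc (x : Lam)) = idc (x : quot_cat I').
Proof.
have -> : idc (x : Lam) = of_reduced (bpath k (@qnil Q' x)).
  by rewrite /of_reduced incl_linE; congr (qclass I (bpath k _)); exact: val_inj.
by rewrite to_of_reduced.
Qed.

Lemma to_reduced_comp x y z (v : @hom k Lam y z) (u : @hom k Lam x y) :
  to_reduced (comp v u) = comp (to_reduced v) (to_reduced u).
Proof.
have [v' <-] := of_reduced_surj v; have [u' <-] := of_reduced_surj u.
have -> : comp (of_reduced v') (of_reduced u') = of_reduced (pcomp v' u').
  by rewrite /of_reduced incl_lin_comp [comp _ _]/= qcompE.
by rewrite !to_of_reduced [RHS]/= qcompE.
Qed.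

Lemma reduced_iso : kcat_iso Lam (quot_cat I').
Proof.
exists (@KFunctor k Lam (quot_cat I') id
  (fun x y => @to_reduced x y : {linear _ -> _})
  to_reduced_id to_reduced_comp); split.
  by exists id.
exact: to_reduced_bij.
Qed.

Lemma alive_two a b : alive [:: a; b] -> b = nxt a.
Proof. by move=> /andP[/eqP[]]. Qed.

Lemma reduced_multiserial : multiserial_relations I'.
Proof.
have next (e f : arrow Q') : path_notin I' [:: e; f] -> val f = nxt (val e).
  move=> [x [y [p [Ep nI]]]]; apply: alive_two; apply: contrapT => /negP dead.
  by apply: nI; rewrite /= incl_linE; apply: I_dead; rewrite /= Ep.
move=> e; split=> f f' /next E /next E'; apply: val_inj; first by rewrite E E'.
by apply: (can_inj nxtK); rewrite -E -E'.
Qed.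

Lemma reduced_src_card x :
  ([set e : arrow Q' | src e = x] #<= [set a : arrow Q | src a = x])%card.
Proof. by apply: (@card_le_inj _ _ val) => //; exact: val_inj. Qed.

Lemma reduced_tgt_card x :
  ([set e : arrow Q' | tgt e = x] #<= [set a : arrow Q | src a = x])%card.
Proof.
apply: (@card_le_inj _ _ (nxt \o val)) => [e /= <-|]; first by rewrite -tgt_nxt.
exact: inj_comp (can_inj nxtK) val_inj.
Qed.

Lemma reduced_locally_finite : locally_finite Q'.
Proof.
move=> x; split; apply: card_le_finite (src_finite x).
  exact: reduced_src_card.
exact: reduced_tgt_card.
Qed.

(** The last arrow of a walk has the same [d] as its successor, which starts at
[x]. *)
Lemma long_dead_into x y s : is_qpath y x s -> (d (rep x) < size s)%N -> ~~ alive s.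
Proof.
case/lastP: s => // s b ps lt; apply/negP => /alive_fullr[|r]; first by case: (s).
rewrite -cats1 -catA => F; have E := full_factor_size (q := [::]) F.
have xb : src (nxt b) = x.
  have [z _] := is_qpath_catP (etrans (congr1 _ (cats1 s b)) ps).
  by rewrite /= tgt_nxt => /andP[_ /eqP].
suff: (size (rcons s b) <= d (rep x))%N by rewrite leqNgt lt.
rewrite -xb; apply: leq_trans (rep_max _).
by rewrite d_nxt -E size_rcons size_cat /= addnS ltnS leq_addr.
Qed.

(** A linear form on the big path category that agrees with a coefficient on
paths of kept arrows computes that coefficient. *)
Lemma incl_coeff x y (p : @qpath Q' x y) (f : phom k (Q := Q) x y -> k^o) :
  linear f -> (forall q : @qpath Q' x y, f (bpath k (incl q)) = (q == p)%:R) ->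
  forall u, f (incl_lin u) = coeff p u.
Proof.
move=> lf fE u; elim/phom_ind: u => [|c u v Hu Hv|q].
- by rewrite coeff0 (lin0 (@incl_lin_linear _ _)) (lin0 lf).
- by rewrite incl_lin_linear lf Hu Hv coeffD coeffZ.
by rewrite incl_linE fE coeffU mul1r.
Qed.

(** The continuation of a kept arrow [e] to a maximal walk turns no other path
of kept arrows from the same vertex into a maximal walk.  If [1 < d e] the
continuation contains an arrow and determines the walk.  If [d e = 1] it is
trivial; then [e], being kept, is [rep x], so all arrows from [x] are maximal
walks and [e] is the only one of them that is kept. *)
Lemma full_arrow_completion x y (e : arrow Q') (p q : @qpath Q' x y) :
  qseq p = [:: e] ->
  full (map val q ++ traject nxt (nxt (val e)) (d (val e)).-1) = (q == p).
Proof.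
move=> Ep; set a := val e; rewrite -val_eqE /= Ep.
have ax : src a = x by have := qseqP p; rewrite Ep => /andP[/eqP].
have Ed : ((d a).-1.+1 = d a)%N by rewrite prednK.
apply/idP/eqP => [F|->]; last first.
  rewrite (_ : _ ++ _ = traject nxt a (d a)) ?full_traject //.
  by rewrite -[in RHS]Ed.
case: q F => -[|f s] /= ps F.
  case n: (d a).-1 F => [|m] // F.
  have := full_size (F : full (nxt a :: traject nxt (nxt (nxt a)) m)).
  by rewrite /= size_traject d_nxt -Ed n => /eqP; rewrite eqn_leq ltnn andbF.
have fx : src (val f) = x by case/andP: ps => /eqP.
have sz := full_size F; rewrite /= size_cat size_map size_traject in sz.
(* Either [a] is maximal, and the path must be [rep x], or the continuation
   starts with [nxt a], whose predecessor is [a]. *)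
case n: (d a).-1 F sz => [|m] F sz.
  have d1 : d a = 1%N by rewrite -Ed n.
  have ar : a = rep x.
    by have := valP e; rewrite /= /keep -/a d1 ax => /eqP.
  have df := rep_max (val f); rewrite fx -ar d1 -sz addn0 ltnS leqn0 size_eq0 in df.
  have fr : val f = rep x.
    by have := valP f; rewrite /= /keep -sz (eqP df) fx => /eqP.
  by rewrite (eqP df); congr [:: _]; apply: val_inj; rewrite fr -ar.
have := @full_factor_size (val f :: map val s) (nxt a)
  (traject nxt (nxt (nxt a)) m) [::].
rewrite cats0 => /(_ F); rewrite /= size_cat size_map /= size_traject d_nxt -Ed n.
rewrite !addnS => -[]; rewrite -[RHS]add0n => /addIn /size0nil s0.
move: F sz; rewrite s0 /= => F sz; congr [:: _]; apply: val_inj.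
by move: F; rewrite /full -sz /= => /eqP[/(can_inj nxtK)].
Qed.

(** The coefficients of the trivial path and of an arrow are given by forms that
vanish on [I]: [aug_form], and [soc_form] after the completion of the arrow. *)
Lemma reduced_coeff0 x y (u : phom k (Q := Q') x y) (p : @qpath Q' x y) :
  I' x y u -> (size p < 2)%N -> coeff p u = 0.
Proof.
move=> Iu; case Ep: (qseq p) => [|e [|e' s]] // _.
  rewrite -(@incl_coeff x y p (@aug_form x y)); first exact: aug_vanish.
    exact: aug_form_linear.
  move=> q; rewrite /aug_form path_formE -val_eqE /= Ep.
  by case: (qseq q).
pose a := val e; pose t := traject nxt (nxt a) (d a).-1.
have pt : is_qpath y (sigma x) t.
  have F := full_traject a; move: (qseqP p); rewrite Ep /= => /andP[/eqP ax /eqP ay].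
  move: F; rewrite -(prednK (d_gt0 a)) trajectS => /full_cons_qpath /=.
  by rewrite -/a ax in ay *; rewrite ay => /andP[].
pose f (v : phom k (Q := Q) x y) : k^o := soc_form (pcomp (bpath k (QPath pt)) v).
have lf : linear f by move=> c v w; rewrite /f pcomp_linearr soc_form_linear.
rewrite -(@incl_coeff x y p f lf).
  by apply: soc_vanish; exact: (ideal_compl I).
by move=> q; rewrite /f pcompE /soc_form path_formE /= (full_arrow_completion _ Ep).
Qed.

Lemma reduced_ge2 x y (u : phom k (Q := Q') x y) : I' x y u -> path_ge k Q' 2 x y u.
Proof.
move=> Iu; apply: (phom_span (T := fun u => path_ge k Q' 2 x y u)).
- exact: ideal0.
- by move=> c v w; exact: idealP.
move=> p nz J; apply; exists p; split => //.
by rewrite leqNgt; apply: contra_neqN nz; exact: reduced_coeff0.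
Qed.

(** Long paths from or to [x] vanish by [long_dead] and [long_dead_into], and the
kernel contains no combination with trivial paths or arrows by [reduced_coeff0]. *)
Lemma reduced_admissible : admissible I'.
Proof.
move=> x; exists (d (rep x)).+1; split => // y; split.
- move=> u /path_ge_span; apply.
  + exact: ideal0.
  + by move=> c v w; exact: idealP.
  + move=> p lt /=; rewrite incl_linE; apply: I_dead.
    by apply: long_dead; rewrite /= size_map.
- by move=> u; exact: reduced_ge2.
- move=> u /path_ge_span; apply.
  + exact: ideal0.
  + by move=> c v w; exact: idealP.
  + move=> p lt /=; rewrite incl_linE; apply: I_dead.
    by apply: long_dead_into (qseqP (incl p)) _; rewrite /= size_map.
- by move=> u; exact: reduced_ge2.
Qed.

Lemma walk_special_multiserial : special_multiserial Lam.
Proof.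
exists Q', I'; split.
- exact: reduced_locally_finite.
- exact: reduced_admissible.
- exact: reduced_multiserial.
- exact: reduced_iso.
Qed.

Lemma walk_special_biserial :
  (forall x, [set a : arrow Q | src a = x] #<= `I_2)%card -> special_biserial Lam.
Proof.
move=> two; exists Q', I'; split.
- exact: reduced_locally_finite.
- exact: reduced_admissible.
- exact: reduced_multiserial.
- exact: reduced_iso.
- move=> x; split; apply: card_le_trans (two x).
    exact: reduced_src_card.
  exact: reduced_tgt_card.
Qed.

End MaximalWalkAlgebra.
End Walks.

Local Open Scope classical_set_scope.

(** * Configurations of type MS *)

Section MSConfiguration.
Variables (E : fBC) (ms : type_MS E).
Local Notation Q := (fb_quiver E).

Lemma arr_inj : injective (@arr E).
Proof.
move=> e h /arr_eq; rewrite !ms => /seteqP[/(_ e) + _] /=.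
by apply.
Qed.

Lemma arrK : cancel (@arr E) (@arr_repr E).
Proof. by move=> e; apply: arr_inj; rewrite arr_reprK. Qed.

Lemma actK (m : int) : cancel (@act E m) (@act E (- m)).
Proof. by move=> e; rewrite -actD addNr act0. Qed.

Definition fb_nxt (a : arrow Q) : arrow Q := arr (act 1 (arr_repr a)).
Definition fb_prv (a : arrow Q) : arrow Q := arr (act (- 1) (arr_repr a)).
Definition fb_len (a : arrow Q) : nat := fbd (arr_repr a).

Lemma fb_nxtK : cancel fb_nxt fb_prv.
Proof. by move=> a; rewrite /fb_prv arrK actK arr_reprK. Qed.

Lemma fb_prvK : cancel fb_prv fb_nxt.
Proof. by move=> a; rewrite /fb_nxt arrK -actD subrr act0 arr_reprK. Qed.

Lemma fb_len_gt0 a : (0 < fb_len a)%N.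
Proof. exact: fbd_gt0. Qed.

Lemma fb_len_nxt a : fb_len (fb_nxt a) = fb_len a.
Proof. by rewrite /fb_len arrK; apply/esym/fb3; exists 1. Qed.

Lemma fb_tgt_nxt (a : arrow Q) : tgt a = src (fb_nxt a).
Proof. by rewrite src_arr. Qed.

Lemma iter_fb_nxt n (e : E) : iter n fb_nxt (arr e) = arr (act n%:Z e).
Proof. by elim: n => [|n IH] /=; rewrite ?act0 // IH /fb_nxt arrK -actD. Qed.

Lemma walk_traject (e : E) n : walk e n = traject fb_nxt (arr e) n.
Proof.
elim: n => // n IH; rewrite trajectSr -IH iter_fb_nxt.
by rewrite /walk -addn1 iotaD map_cat cats1.
Qed.

Lemma fb_src_surj (x : vertex Q) : exists a : arrow Q, src a = x.
Proof.
have [e _ ex] := set_mem (valP x); exists (arr e); rewrite src_arr.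
exact: val_inj.
Qed.

Lemma fb_src_card (e : E) :
  ([set a : arrow Q | src a = vtx e] #<= fbP e)%card.
Proof.
apply: (@card_le_inj _ _ (@arr_repr E)) => [a /vtx_eq <-|].
  exact: (fbP_partition E).2.
exact: can_inj (@arr_reprK E).
Qed.

Lemma fb_src_finite (x : vertex Q) : finite_set [set a : arrow Q | src a = x].
Proof.
have [a <-] := fb_src_surj x.
exact: card_le_finite (fb_src_card _) (fb1 _).2.
Qed.

Lemma fb_src_end (a b : arrow Q) : src a = src b <->
  src (iter (fb_len a) fb_nxt a) = src (iter (fb_len b) fb_nxt b).
Proof.
rewrite -[a]arr_reprK -[b]arr_reprK !iter_fb_nxt !src_arr !vtx_eq /fb_len !arrK.
exact: fb4.
Qed.

Local Notation falive := (alive fb_nxt fb_len).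
Local Notation ffull := (full fb_nxt fb_len).

Lemma walk_full (e : E) : ffull (walk e (fbd e)).
Proof.
have -> : walk e (fbd e) = traject fb_nxt (arr e) (fb_len (arr e)).
  by rewrite walk_traject /fb_len arrK.
exact: (full_traject fb_nxt fb_len_gt0).
Qed.

Lemma full_walk s : ffull s -> exists e : E, s = walk e (fbd e).
Proof.
move/(fullP fb_nxt fb_len_gt0) => [a ->]; exists (arr_repr a).
by rewrite walk_traject arr_reprK.
Qed.

(** The intersection in [fR2] consists of the common value of the translates, so
it is non-empty exactly when the path is a walk. *)
Lemma common_translate n (e : nat -> E) :
  \bigcap_(i in [set i | (1 <= i <= n.+1)%N])
     (act (n.+1 - i)%N%:Z @` fbL (e i)) = set0 <->
  ~ (forall i, (i < n.+1)%N -> e i.+1 = act i%:Z (e 1%N)).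
Proof.
have actS i : (i <= n)%N -> act (n - i)%N%:Z (act i%:Z (e 1%N)) = act n%:Z (e 1%N).
  by move=> le; rewrite -actD -PoszD subnK.
split=> [cap H|NH].
  suff: (set0 : set E) (act n%:Z (e 1%N)) by [].
  rewrite -cap => -[//|i] /= lt; exists (e i.+1); first by rewrite ms.
  by rewrite (H i lt) subSS actS.
apply/seteqP; split=> // z cap; apply: NH => i lt.
have shift j : (j < n.+1)%N -> act (n - j)%N%:Z (e j.+1) = z.
  by move=> ltj; have [w + <-] := cap j.+1 ltj; rewrite ms subSS => ->.
apply: (can_inj (actK (n - i)%N%:Z)).
by rewrite actS // shift // -(shift 0%N) // subn0.
Qed.

Variable k : fieldType.
Local Notation I := (fb_ideal E k).

(** A path that is not a walk is a relation [fR2], a walk that is too long is a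
relation [fR3]. *)
Lemma fb_dead x y (p : @qpath Q x y) : ~~ falive p -> I x y (bpath k p).
Proof.
case Ep: (qseq p) => [|a s]; first by move=> /negP[].
move=> dead; rewrite /fb_ideal /= => J RJ; apply: RJ.
have [Es|NE] := eqVneq (a :: s) (traject fb_nxt a (size (a :: s))).
  right; exists (arr_repr a), (size (a :: s)), p; split => //.
    by move: dead; rewrite /alive -Es eqxx /= -ltnNge.
  by rewrite walk_traject arr_reprK Ep.
(* The elements of a path in [fR2] are numbered from 1. *)
left; right; exists (size (a :: s)), (fun i => arr_repr (nth a (a :: s) i.-1)), p.
split => //.
- by case: s NE {Ep dead} => //=; rewrite eqxx.
- rewrite Ep; apply: (@eq_from_nth _ a); first by rewrite size_map size_iota.
  move=> i lt; rewrite (nth_map 0%N) ?size_iota // nth_iota // add1n /=.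
  by rewrite arr_reprK.
apply/common_translate => H; case/eqP: NE.
apply: (@eq_from_nth _ a); first by rewrite size_traject.
move=> i lt; rewrite nth_traject // -[LHS]arr_reprK (H i lt) /=.
by rewrite -iter_fb_nxt arr_reprK.
Qed.

Lemma fb_full x y (p q : @qpath Q x y) :
  ffull p -> ffull q -> I x y (bpath k p - bpath k q).
Proof.
have src_walk (r : @qpath Q x y) e : qseq r = walk e (fbd e) -> x = vtx e.
  move=> Er; move: (qseqP r); rewrite Er walk_traject.
  case: (fbd e) (fbd_gt0 e) => // n _; rewrite (is_qpath_traject fb_tgt_nxt).
  by rewrite src_arr => /andP[/eqP].
move=> /full_walk[e Ee] /full_walk[h Eh]; rewrite /fb_ideal /= => J RJ.
apply: RJ; left; left.
exists e, h, 0%N, p, q; rewrite !subn0; split => //; split => //.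
- exact: src_walk Ee.
- by apply/vtx_eq; rewrite -(src_walk p e Ee) -(src_walk q h Eh).
by case.
Qed.

(** The relations [fR1] with a positive number of common arrows are trivial: a
common last arrow puts the two starting elements on one orbit at the same
distance from it, so they are equal.  Only the differences of maximal walks
remain. *)
Lemma fb_min (J : ideal (path_cat k Q)) :
  (forall x y (p : @qpath Q x y), ~~ falive p -> J x y (bpath k p)) ->
  (forall x y (p q : @qpath Q x y), ffull p -> ffull q ->
     J x y (bpath k p - bpath k q)) ->
  forall x y u, I x y u -> J x y u.
Proof.
move=> Jdead Jfull x y u; apply=> {x y u} x y u [[|]|].
- move=> [e [h [n [p [q [[xe eh le tails] [Ep Eq ->]]]]]]].
  case: n le tails Ep Eq => [|n] le tails Ep Eq.
    by apply: Jfull; rewrite ?Ep ?Eq !subn0; exact: walk_full.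
  (* For [i = 1] the hypothesis compares the last arrows of the maximal walks. *)
  have := tails 1%N isT; rewrite !ms => /seteqP[/(_ _ erefl) /= E1 _].
  have de : fbd e = fbd h.
    apply: fb3; exists (- (fbd h - 1)%N%:Z + (fbd e - 1)%N%:Z).
    by rewrite actD E1 actK.
  have eh' : e = h by apply: (can_inj (actK (fbd h - 1)%N%:Z)); rewrite -E1 de.
  have -> : p = q by apply: val_inj; rewrite /= Ep Eq eh'.
  by rewrite subrr; exact: ideal0.
- move=> [n [e [p [n1 Ep cap ->]]]]; apply: Jdead; rewrite Ep.
  case: n n1 Ep cap => [//|n] n1 Ep /common_translate H.
  apply/negP => /andP[/eqP al _]; apply: H => i lt.
  have := congr1 (fun s => nth (arr (e 1%N)) s i) al.
  rewrite size_map size_iota nth_traject //.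
  rewrite -/(map _ (iota 1 n.+1)) (nth_map 0%N) ?size_iota // nth_iota // add1n.
  by rewrite iter_fb_nxt => /arr_inj.
- move=> [e [n [p [lt Ep ->]]]]; apply: Jdead; rewrite Ep walk_traject.
  case: n lt {Ep} => // n lt; rewrite /alive /= negb_and -ltnNge size_traject.
  by rewrite /fb_len arrK lt orbT.
Qed.

Lemma fb_locally_bounded : locally_bounded (fb_cat k E).
Proof.
exact: (walk_locally_bounded fb_nxtK fb_prvK fb_len_gt0 fb_len_nxt fb_tgt_nxt
  fb_src_finite fb_src_surj fb_src_end fb_dead fb_full fb_min).
Qed.

Lemma fb_frobenius : frobenius (fb_cat k E).
Proof.
exact: (walk_frobenius fb_nxtK fb_prvK fb_len_gt0 fb_len_nxt fb_tgt_nxt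
  fb_src_finite fb_src_surj fb_src_end fb_dead fb_full fb_min).
Qed.

Lemma fb_special_multiserial : special_multiserial (fb_cat k E).
Proof.
exact: (walk_special_multiserial fb_nxtK fb_len_gt0 fb_len_nxt fb_tgt_nxt
  fb_src_finite fb_src_surj fb_src_end fb_dead fb_full fb_min).
Qed.

Lemma fb_special_biserial :
  (forall e : E, fbP e #= `I_2)%card -> special_biserial (fb_cat k E).
Proof.
move=> two.
apply: (walk_special_biserial fb_nxtK fb_len_gt0 fb_len_nxt fb_tgt_nxt
  fb_src_finite fb_src_surj fb_src_end fb_dead fb_full fb_min) => x.
have [a <-] := fb_src_surj x; apply: card_le_trans (fb_src_card _) _.
by have /card_eqPle[] := two (arr_repr a).
Qed.

End MSConfiguration.

Theorem proposition6p6 (k : fieldType) (E : fBC) :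
  (type_MS E ->
     locally_bounded (fb_cat k E) /\
     special_multiserial (fb_cat k E) /\
     frobenius (fb_cat k E)) /\
  (fBG_MS E ->
     locally_bounded (fb_cat k E) /\
     special_biserial (fb_cat k E) /\
     frobenius (fb_cat k E)).
Proof.
split=> [ms|[ms two]].
  split; first exact: fb_locally_bounded.
  by split; [exact: fb_special_multiserial|exact: fb_frobenius].
split; first exact: fb_locally_bounded.
by split; [exact: fb_special_biserial|exact: fb_frobenius].
Qed.
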